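(* Let $\mathcal Q$ be a strictly admissible mesh of class $m\ge2$ and $\mathcal M$ the set of elements of $\mathcal Q$ marked for refinement. The call $\mathcal Q^*=\mathrm{REFINE}(\mathcal Q,\mathcal M,m)$ terminates and returns a strictly admissible mesh $\mathcal Q^*\succeq\mathcal Q$ of class $m$.
   Context: HIERARCHICAL MESHES. Let $V^0\subset V^1\subset V^2\subset\cdots$ be nested tensor-product $d$-variate spline spaces on a closed hyper-rectangle $D\subset\mathbb R^d$; $V^\ell$ is spanned by the tensor-product B-spline basis $\hat{\mathcal B}^\ell$ of degree $\mathbf p=(p_1,\ldots,p_d)$ on a tensor-product grid $\hat G^\ell$ of open cells, $\hat G^{\ell+1}$ being the dyadic refinement of $\hat G^\ell$ (each cell is split into $2^d$ children). A domain hierarchy of depth $N$ consists of closed sets $\hat\Omega^0\supseteq\cdots\supseteq\hat\Omega^{N-1}$ in $D$, $\hat\Omega^N=\emptyset$, with $\hat\Omega^\ell$ ($\ell\ge1$) a union of closures of cells of $\hat G^{\ell-1}$ (and $\hat\Omega^0$ a union of closures of cells of $\hat G^0$). Active elements of level $\ell$: $\hat{\mathcal G}^\ell=\{\hat Q\in\hat G^\ell:\hat Q\subset\hat\Omega^\ell$ and no $\hat Q^*\in\hat G^{\ell^*}$, $\ell^*>\ell$, satisfies $\hat Q^*\subset\hat\Omega^{\ell^*}$ and $\hat Q^*\subset\hat Q\}$. Mesh: $\hat{\mathcal Q}=\bigcup_\ell\hat{\mathcal G}^\ell$. $\hat{\mathcal Q}^*\succeq\hat{\mathcal Q}$ (refinement)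 means that each element of $\hat{\mathcal Q}^*$ either belongs to $\hat{\mathcal Q}$ or is obtained from an element of $\hat{\mathcal Q}$ by (possibly repeated) dyadic splitting. Supports of B-splines are intersected with $\hat\Omega^0$. For $\hat Q\in\hat G^\ell$ and $k\le\ell$, $S(\hat Q,k)=\{\hat Q'\in\hat G^k:\exists\hat\beta\in\hat{\mathcal B}^k,\ \operatorname{supp}\hat\beta\cap\hat Q'\ne\emptyset,\ \operatorname{supp}\hat\beta\cap\hat Q\ne\emptyset\}$ (also the region covered by the closures of its elements); $\hat\omega^\ell=\bigcup\{\overline{\hat Q}:\hat Q\in\hat G^\ell,\ S(\hat Q,\ell)\subseteq\hat\Omega^\ell\}$. The mesh is strictly admissible of class $m$ if $\hat\Omega^\ell\subseteq\hat\omega^{\ell-m+1}$ for $\ell=m,\ldots,N-1$. Let $\mathbf F:\hat\Omega^0\to\overline\Omega$ be a bi-Lipschitz homeomorphism. Physical meshes, grids, active elements, subdomains and support extensions are the images under $\mathbf F$ of the parametric ones and are written without hats: $\mathcal Q=\{\mathbf F(\hat Q):\hat Q\in\hat{\mathcal Q}\}$, $\mathcal G^\ell$, $G^\ell$, $\Omega^\ell=\mathbf F(\hat\Omega^\ell)$, $\omega^\ell=\mathbf F(\hat\omega^\ell)$, $S(Q,k)$; $\mathcal Q$ is strictly admissible if $\hat{\mathcal Q}$ is, and $\mathcal Q^*\succeq\mathcal Q$ if $\hat{\mathcal Q}^*\succeq\hat{\mathcal Q}$. NEIGHBORHOOD. For $Q\in\mathcal Q\cap\mathcal G^\ell$: $\mathcal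 N(\mathcal Q,Q,m)=\{Q'\in\mathcal G^{\ell-m+1}:\exists\,Q''\in S(Q,\ell-m+2),\ Q''\subseteq Q'\}$ if $\ell-m+1\ge0$, and $\mathcal N(\mathcal Q,Q,m)=\emptyset$ if $\ell-m+1<0$ (here $\mathcal G^{\ell-m+1}$ are the active elements of level $\ell-m+1$ of $\mathcal Q$). REFINE\_RECURSIVE$(\mathcal Q,Q,m)$: for all $Q'\in\mathcal N(\mathcal Q,Q,m)$, set $\mathcal Q=\mathrm{REFINE\_RECURSIVE}(\mathcal Q,Q',m)$; then, if $Q$ has not been subdivided, subdivide $Q$ and update $\mathcal Q$ by replacing $Q$ with its $2^d$ children (of the next level; the subdomain of that level is enlarged by $\overline Q$). Return $\mathcal Q$. REFINE$(\mathcal Q,\mathcal M,m)$: for all $Q\in\mathcal Q\cap\mathcal M$ (elements of $\mathcal M$ still present in the current mesh), set $\mathcal Q=\mathrm{REFINE\_RECURSIVE}(\mathcal Q,Q,m)$; return $\mathcal Q^*=\mathcal Q$. *)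

(* Defs.v *)
From HB Require Import structures.
From Stdlib Require Import List Relation_Operators.
From mathcomp Require Import all_boot all_order all_algebra.
From mathcomp Require Import all_classical all_reals all_analysis.

Set Implicit Arguments.
Unset Strict Implicit.
Unset Printing Implicit Defensive.

Import Order.TTheory GRing.Theory Num.Theory.
Import numFieldNormedType.Exports.
Local Open Scope classical_set_scope.
Local Open Scope ring_scope.

Section Univariate.
Context (R : realType).
Implicit Types (z t : seq R).

(* z = z_0 < ... < z_n lists the breakpoints of a grid of the interval
   [z_0, z_n]; bisect inserts the midpoint of every cell. *)
Fixpoint bisect z : seq R :=
  match z with
  | x :: ((y :: _) as z') => x :: (x + y) / 2 :: bisect z'
  | _ => z
  end.

Definition breakpoints z := sorted <%R z /\ (1 < size z)%N.

(* A p-open knot vector with distinct knots z. Multiplicity p + 1 at interior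
   knots (splines discontinuous there) is allowed. *)
Definition open_knot_vector (p : nat) z t :=
  [/\ sorted <=%R t, t =i z,
      forall x, (count_mem x t <= p.+1)%N,
      count_mem (head 0 z) t = p.+1 & count_mem (last 0 z) t = p.+1].

(* Cox-de Boor recursion for the j-th B-spline of degree p; terms with a
   vanishing denominator are 0 since 0^-1 = 0. In degree 0 the cells are
   half-open, except that the rightmost one contains the right end point of the
   interval. B-splines vanish off the interval spanned by the knots. *)
Fixpoint bspline t (p j : nat) (x : R) : R :=
  match p with
  | 0%N => ((t`_j <= x < t`_j.+1) ||
            [&& t`_j < x, x == t`_j.+1 & x == last 0 t])%:R
  | q.+1 => (x - t`_j) / (t`_(j + q.+1) - t`_j) * bspline t q j x
          + (t`_(j + q.+2) - x) / (t`_(j + q.+2) - t`_j.+1)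
            * bspline t q j.+1 x
  end.

End Univariate.

Section Parametric.
Context (R : realType) (d : nat).
Notation point := 'rV[R]_d.

(* breaks i are the breakpoints in direction i of the grid of level 0 on
   D = \prod_i [head (breaks i), last (breaks i)], and knots l i is the knot
   vector of level l in direction i. *)
Record spline_data := SplineData {
  degree : 'I_d -> nat;
  breaks : 'I_d -> seq R;
  knots : nat -> 'I_d -> seq R }.

Variable S : spline_data.

Definition grid (l : nat) (i : 'I_d) : seq R := iter l (@bisect R) (breaks S i).

(* The open cells of the tensor-product grid of level l. *)
Definition cell (l : nat) : set (set point) := [set Q |
  exists2 j : 'I_d -> nat, (forall i, (j i).+1 < size (grid l i))%N &
    Q = [set x : point |
          forall i, (grid l i)`_(j i) < x 0 i < (grid l i)`_(j i).+1]].

Definition basis (l : nat) : set (point -> R) := [set beta |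
  exists2 j : 'I_d -> nat,
    (forall i, j i + (degree S i).+1 < size (knots S l i))%N &
    beta = fun x : point => \prod_i bspline (knots S l i) (degree S i) (j i) (x 0 i)].

(* The span of the basis; its elements are extended by 0 outside D. *)
Definition spline_space (l : nat) : set (point -> R) := [set f |
  exists n (c : 'I_n -> R) (beta : 'I_n -> point -> R),
    (forall k, basis l (beta k)) /\ f = fun x : point => \sum_k c k * beta k x].

Definition nested_spline_spaces :=
  [/\ forall i, breakpoints (breaks S i),
      forall l i, open_knot_vector (degree S i) (grid l i) (knots S l i) &
      forall l, spline_space l `<=` spline_space l.+1].

Record hierarchy := Hierarchy {
  depth : nat;
  dom : nat -> set point }.

Definition union_of_cells (l : nat) (A : set point) :=
  exists2 C : set (set point), C `<=` cell l & A = \bigcup_(Q in C) closure Q.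

Definition domain_hierarchy (H : hierarchy) :=
  [/\ (0 < depth H)%N,
      forall l, dom H l.+1 `<=` dom H l,
      forall l, (depth H <= l)%N -> dom H l = set0,
      forall l, closed (dom H l) &
      union_of_cells 0 (dom H 0) /\
      forall l, union_of_cells l (dom H l.+1)].

Definition active (H : hierarchy) (l : nat) : set (set point) := [set Q |
  [/\ cell l Q, Q `<=` dom H l &
      ~ exists l' Q', [/\ (l < l')%N, cell l' Q', Q' `<=` dom H l' & Q' `<=` Q]]].

Definition param_mesh (H : hierarchy) : set (set point) :=
  \bigcup_l active H l.

Definition dyadic_child (Q' Q : set point) :=
  exists l, [/\ cell l Q, cell l.+1 Q' & Q' `<=` Q].

Definition refinement (H' H : hierarchy) :=
  forall Q', param_mesh H' Q' ->
    param_mesh H Q' \/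
    exists2 Q, param_mesh H Q & clos_trans _ dyadic_child Q' Q.

Definition support (H : hierarchy) (beta : point -> R) : set point :=
  closure [set x | beta x != 0] `&` dom H 0.

(* S(Q, k), meant for Q in the grid of a level l >= k *)
Definition support_extension (H : hierarchy) (Q : set point) (k : nat)
  : set (set point) := [set Q' | cell k Q' /\
    exists beta, [/\ basis k beta, support H beta `&` Q' !=set0 &
                     support H beta `&` Q !=set0]].

Definition region (A : set (set point)) : set point :=
  \bigcup_(Q in A) closure Q.

Definition omega (H : hierarchy) (l : nat) : set point :=
  region [set Q | cell l Q /\ region (support_extension H Q l) `<=` dom H l].

Definition strictly_admissible (m : nat) (H : hierarchy) :=
  forall l, (m <= l < depth H)%N -> dom H l `<=` omega H (l - m).+1.

End Parametric.

Arguments Hierarchy {R d}.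

Section Physical.
Context (R : realType) (d : nat).
Notation point := 'rV[R]_d.

Definition bilipschitz_homeomorphism (A B : set point) (F : point -> point) :=
  set_bij A B F /\
  exists c C : R, 0 < c /\ forall x y, A x -> A y ->
    c * `|x - y| <= `|F x - F y| <= C * `|x - y|.

Variables (S : spline_data R d) (F : point -> point).
Implicit Types (H : hierarchy R d) (Q : set point).

(* F is meaningful on dom H 0 only, so only cells inside dom H 0 are mapped. *)
Definition phys_grid H (l : nat) : set (set point) :=
  [set F @` Q | Q in [set Q | cell S l Q /\ Q `<=` dom H 0]].

Definition phys_active H (l : nat) : set (set point) :=
  [set F @` Q | Q in active S H l].

Definition mesh H : set (set point) := \bigcup_l phys_active H l.

Definition phys_support_extension H Q (k : nat) : set (set point) :=
  [set P | exists l Q0, [/\ (k <= l)%N, cell S l Q0, Q0 `<=` dom H 0,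
     Q = F @` Q0 & exists2 Q1, support_extension S H Q0 k Q1 & P = F @` Q1]].

(* N(mesh H, Q, m). Also defined for a Q that has left the mesh by
   subdivision, since the recursion may visit such a Q. *)
Definition neighborhood H Q (m : nat) : set (set point) :=
  [set P | exists l, [/\ phys_grid H l Q, (m <= l.+1)%N,
     phys_active H (l.+1 - m) P &
     exists2 P', phys_support_extension H Q (l.+2 - m) P' & P' `<=` P]].

Definition enlarge H (l : nat) (A : set point) :=
  Hierarchy (maxn (depth H) l.+1)
    (fun k => if k == l then dom H k `|` A else dom H k).

(* Subdividing Q = F(Q0), Q0 active of level l, enlarges the subdomain of level
   l + 1 by closure Q0; thereby the children of Q0 become active in place
   of Q0. An element that is no longer in the mesh is left alone. *)
Definition subdivision H Q H' :=
  (exists l Q0, [/\ active S H l Q0, Q = F @` Q0 &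
                    H' = enlarge H l.+1 (closure Q0)])
  \/ (~ mesh H Q /\ H' = H).

Definition enumerates T (s : seq T) (A : set T) :=
  List.NoDup s /\ forall x, List.In x s <-> A x.

(* The order of the loops is left open: refine_recursive m H Q H' means that
   some run of REFINE_RECURSIVE(mesh H, Q, m) returns mesh H', and
   refine_recursive_terminates that all of its runs are finite. The
   neighborhood is evaluated once, on entry of the loop. *)
Inductive refine_recursive (m : nat) : hierarchy R d -> set point ->
    hierarchy R d -> Prop :=
| RefineRecursive H Q s H1 H2 :
    enumerates s (neighborhood H Q m) -> refine_all m H s H1 ->
    subdivision H1 Q H2 -> refine_recursive m H Q H2
with refine_all (m : nat) : hierarchy R d -> seq (set point) ->
    hierarchy R d -> Prop :=
| RefineAllNil H : refine_all m H [::] H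
| RefineAllCons H Q s H1 H2 :
    refine_recursive m H Q H1 -> refine_all m H1 s H2 ->
    refine_all m H (Q :: s) H2.

Inductive refine_recursive_terminates (m : nat) : hierarchy R d ->
    set point -> Prop :=
| RefineRecursiveTerminates H Q :
    finite_set (neighborhood H Q m) ->
    (forall s, enumerates s (neighborhood H Q m) ->
       refine_all_terminates m H s) ->
    refine_recursive_terminates m H Q
with refine_all_terminates (m : nat) : hierarchy R d ->
    seq (set point) -> Prop :=
| RefineAllTerminatesNil H : refine_all_terminates m H [::]
| RefineAllTerminatesCons H Q s :
    refine_recursive_terminates m H Q ->
    (forall H1, refine_recursive m H Q H1 -> refine_all_terminates m H1 s) ->
    refine_all_terminates m H (Q :: s).

(* REFINE(mesh H, M, m): marked elements still present in the current mesh are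
   processed, in any order, until there are none left. *)
Inductive refine (m : nat) (M : set (set point)) :
    hierarchy R d -> hierarchy R d -> Prop :=
| RefineDone H : mesh H `&` M = set0 -> refine m M H H
| RefineStep H Q H1 H2 :
    (mesh H `&` M) Q -> refine_recursive m H Q H1 -> refine m M H1 H2 ->
    refine m M H H2.

Inductive refine_terminates (m : nat) (M : set (set point)) :
    hierarchy R d -> Prop :=
| RefineTerminates H :
    (forall Q, (mesh H `&` M) Q -> refine_recursive_terminates m H Q) ->
    (forall Q H1, (mesh H `&` M) Q -> refine_recursive m H Q H1 ->
       refine_terminates m M H1) ->
    refine_terminates m M H.

End Physical.

(* Main.v *)
From Stdlib Require Import Relation_Operators.
From mathcomp Require Import all_boot all_order all_algebra.
From mathcomp Require Import all_classical all_reals all_analysis.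
From mathcomp Require Import ring lra zify.
Require Import Defs.

(** The recursion of REFINE_RECURSIVE goes from an element of level l to elements
    of level l + 1 - m, which is smaller than l because m is at least 2; so it
    terminates. A call only enlarges the domains of the hierarchy, and it
    removes the element that it is called for from the mesh for good. Hence each
    pass of REFINE decreases the number of marked elements in the mesh, and the
    loop ends. That the final mesh refines the original one follows from the
    growth of the domains alone (extends_refinement): descending from level 0 to
    an element of the new mesh one meets an element of the old mesh, or the new
    element is one of these.

    The point is that strict admissibility is preserved. Subdividing Q of level
    l adds Q to the domain of level l + 1, so the support extension
    S(Q, l + 2 - m) has to lie in the domain of level l + 2 - m. Let Q' be one
    of its cells, and P' the parent of Q', of level l + 1 - m. Admissibility of
    the given mesh puts the support extension of Q of level l + 1 - m in the
    domain of that level, and P' belongs to this support extension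
    (support_extension_parent). So either Q' is in the required domain already,
    or P' is active; then P' is in the neighborhood of Q and has been subdivided
    before Q, which puts it in the required domain
    (support_extension_refined).

    What remains is a fact on splines (basis_coarsen): if a B-spline of
    level k + 1 is nonzero on two cells, then some B-spline of level k is nonzero
    on both. It is deduced from the nestedness of the spline spaces. As
    B-splines are tensor products, one may argue in one variable. The sum of the
    coarse B-splines that do not vanish near x is 1 near x, so that in terms of
    fine B-splines it has coefficient 1 at each one that does not vanish near x.
    If one of these also does not vanish near y, then the sum is not zero near
    y, since B-splines are locally linearly independent. Local independence is
    proved by Marsden's identity: on a knot interval, p + 1 B-splines of degree p
    span all polynomials of degree at most p. *)

Set Implicit Arguments.
Unset Strict Implicit.
Unset Printing Implicit Defensive.

Import Order.TTheory GRing.Theory Num.Theory.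
Import numFieldNormedType.Exports.
Local Open Scope classical_set_scope.
Local Open Scope ring_scope.

(** * Univariate B-splines *)

Section UnivariateSplines.
Context (R : realType).
Implicit Types (t : seq R) (x y : R) (p j : nat).

Lemma knots_le t i j : sorted <=%R t -> (i <= j)%N -> (j < size t)%N ->
  t`_i <= t`_j.
Proof.
move=> st ij jt; apply: (le_sorted_leq_nth _ st) => //.
by rewrite inE (leq_ltn_trans ij).
Qed.

Lemma knot_neq t x j : x \notin t -> (j < size t)%N -> (t`_j == x) = false.
Proof.
move=> xt jt; apply/negbTE; apply: contra xt => /eqP <-; exact: mem_nth.
Qed.

Lemma knot_leF t x j : x \notin t -> (j < size t)%N ->
  (t`_j <= x) = (t`_j < x).
Proof. by move=> xt jt; rewrite le_eqVlt knot_neq. Qed.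

Lemma knot_ltN t x j : x \notin t -> (j < size t)%N ->
  (x < t`_j) = ~~ (t`_j < x).
Proof. by move=> xt jt; rewrite ltNge knot_leF. Qed.

(** The points are kept off the knots, at which the value depends on the
    half-open convention of degree 0. In the recursion at least one of the two
    terms is positive, because the supports of the two B-splines of lower degree
    overlap or abut. *)
Lemma bspline_sign t p j x : sorted <=%R t -> x \notin t ->
  (j + p.+1 < size t)%N ->
  if t`_j < x < t`_(j + p.+1) then is_true (0 < bspline t p j x)
  else bspline t p j x = 0.
Proof.
move=> st xt; elim: p j => [|q IH] j hj /=.
  rewrite addn1 in hj *.
  rewrite knot_leF ?(ltnW hj) // (eq_sym x) knot_neq //= andbF orbF.
  by case: ifP => ->; rewrite ?ltr01.
have h1 : (j + q.+1 < size t)%N by apply: ltn_trans hj; rewrite ltn_add2l.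
have h2 : (j.+1 + q.+1 < size t)%N by rewrite addSnnS.
move: (IH j h1) (IH j.+1 h2); rewrite addSnnS.
set A := t`_j; set B := t`_(j + q.+1); set C := t`_j.+1; set D := t`_(j + q.+2).
set N1 := bspline t q j x; set N2 := bspline t q j.+1 x.
have AC : A <= C by apply: knots_le => //; apply: leq_ltn_trans h2; lia.
have BD : B <= D by apply: knots_le => //; lia.
have CB : C <= B by apply: knots_le => //; lia.
have xB : (x < B) = ~~ (B < x) by apply: knot_ltN.
have xC : (x < C) = ~~ (C < x) by apply: knot_ltN => //; lia.
have term1 : A < x < B -> 0 < N1 -> 0 < (x - A) / (B - A) * N1.
  by move=> /andP[h h'] N0; rewrite mulr_gt0 // divr_gt0 // subr_gt0 // (lt_trans h).
have term2 : C < x < D -> 0 < N2 -> 0 < (D - x) / (D - C) * N2.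
  by move=> /andP[h h'] N0; rewrite mulr_gt0 // divr_gt0 // subr_gt0 // (lt_trans h).
case: ifP => [AxB|AxB]; case: ifP => [CxD|CxD] H1 H2.
- have -> : A < x < D by case/andP: AxB => -> _; case/andP: CxD.
  by rewrite addr_gt0 // ?term1 ?term2.
- have -> : A < x < D.
    by case/andP: AxB => -> h; rewrite (lt_le_trans h BD).
  by rewrite H2 mulr0 addr0 term1.
- have -> : A < x < D.
    by case/andP: CxD => h ->; rewrite (le_lt_trans AC h).
  by rewrite H1 mulr0 add0r term2.
- have -> : (A < x < D) = false.
    apply/negbTE/negP => /andP[hA hD].
    move: AxB CxD; rewrite hA hD andbT /= xB => /negbFE Bx.
    by rewrite (le_lt_trans CB Bx).
  by rewrite H1 H2 !mulr0 addr0.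
Qed.

Lemma bspline_neq0 t p j x : sorted <=%R t -> x \notin t ->
  (j + p.+1 < size t)%N ->
  (bspline t p j x != 0) = (t`_j < x < t`_(j + p.+1)).
Proof.
move=> st xt hj; have := bspline_sign st xt hj.
by case: ifP => _; [move/lt0r_neq0 | move=> ->; rewrite eqxx].
Qed.

(** The j-th factor in Marsden's identity. Its coefficients are, up to factors
    that do not depend on j, the coefficients of the monomials with respect to
    the B-splines of degree p. *)
Definition dual_poly t p j : {poly R} :=
  \prod_(i < p) ('X - (t`_(j + i.+1))%:P).

Lemma dual_polySr t p j :
  dual_poly t p.+1 j = dual_poly t p j * ('X - (t`_(j + p.+1))%:P).
Proof. by rewrite /dual_poly big_ord_recr. Qed.

Lemma dual_polySl t p j :
  dual_poly t p.+1 j = ('X - (t`_j.+1)%:P) * dual_poly t p j.+1.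
Proof.
rewrite /dual_poly big_ord_recl addn1; congr (_ * _).
by apply: eq_bigr => i _; rewrite /= /bump /= add1n addnS addSn.
Qed.

Lemma lead_dual_poly t p j : (dual_poly t p j)`_p = 1.
Proof.
have mo : dual_poly t p j \is monic by apply: monic_prod_XsubC.
have := monicP mo; rewrite /lead_coef /dual_poly.
by rewrite size_prod_XsubC -[index_enum _]enumT size_enum_ord.
Qed.

(** Marsden's identity. The recursion of the B-splines turns the right-hand
    side for degree p.+1 into the one for degree p, because
    (x - a) (X - b) + (b - x) (X - a) = (b - a) (X - x). *)
Lemma marsden t p n x : sorted <=%R t -> x \notin t -> (n + p < size t)%N ->
  t`_p < x < t`_n ->
  ('X - x%:P) ^+ p = \sum_(j < n) bspline t p j x *: dual_poly t p j.
Proof.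
move=> st xt; elim: p n => [|p IH] n hn /andP[h0 h1].
  rewrite addn0 in hn; rewrite expr0.
  pose f (j : nat) : {poly R} := (t`_j < x)%R%:R.
  transitivity (\sum_(j < n) - (f j.+1 - f j)).
    rewrite sumrN -(big_mkord xpredT (fun j => f j.+1 - f j)) telescope_sumr //.
    by rewrite /f h0 ltNge (ltW h1) sub0r opprK.
  apply: eq_bigr => j _.
  have jn : (j.+1 < size t)%N by apply: leq_ltn_trans hn.
  rewrite /dual_poly big_ord0 /f.
  have j1 : (j + 1 < size t)%N by rewrite addn1.
  have := bspline_sign (p := 0) st xt j1; rewrite /= addn1.
  rewrite knot_leF ?(ltnW jn) // (eq_sym x) knot_neq //= andbF orbF.
  rewrite (knot_ltN xt jn); have := knots_le st (leqnSn j) jn.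
  case: (ltP t`_j x) => hj; case: (ltP t`_j.+1 x) => hj1 //= le _;
    rewrite ?scale0r ?scale1r ?subrr ?subr0 ?sub0r ?opprK ?oppr0 //.
  by case/negP: (le_gtF hj); apply: le_lt_trans hj1.
have ps : (p < size t)%N by lia.
have p1s : (p.+1 < size t)%N by lia.
have n1s : (n.+1 < size t)%N by lia.
have H0 : t`_p < x by apply: le_lt_trans h0; apply: knots_le.
have H1 : x < t`_n.+1 by apply: (lt_le_trans h1); apply: knots_le.
have hn1 : (n.+1 + p < size t)%N by lia.
rewrite exprS (IH n.+1) ?H0 ?H1 //.
(* a j and b j are the contributions of the j-th B-spline of degree p to the
   j-th and to the (j - 1)-th B-spline of degree p + 1. The sum over the n
   B-splines of degree p + 1 becomes one over n + 1 indices, as a n and b 0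
   vanish: x lies strictly between the knots of indices p + 1 and n. *)
pose a (j : nat) : R := (x - t`_j) / (t`_(j + p.+1) - t`_j) * bspline t p j x.
pose b (j : nat) : R := (t`_(j + p.+1) - x) / (t`_(j + p.+1) - t`_j) * bspline t p j x.
have -> : \sum_(j < n) bspline t p.+1 j x *: dual_poly t p.+1 j =
  \sum_(j < n) a j *: dual_poly t p.+1 j + \sum_(j < n) b j.+1 *: dual_poly t p.+1 j.
  rewrite -big_split; apply: eq_bigr => j _ /=.
  by rewrite -scalerDl /a /b addSnnS.
have an : a n = 0.
  have := @bspline_sign t p n x st xt; rewrite ltNge (ltW h1) /=.
  by rewrite /a => ->; [rewrite mulr0 | lia].
have b0 : b 0%N = 0.
  have := @bspline_sign t p 0 x st xt.
  rewrite add0n [x < _]ltNge (ltW h0) andbF /= => B0.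
  by rewrite /b B0 ?mulr0.
have -> : \sum_(j < n) a j *: dual_poly t p.+1 j =
          \sum_(j < n.+1) a j *: dual_poly t p.+1 j.
  by rewrite big_ord_recr /= an scale0r addr0.
have -> : \sum_(j < n) b j.+1 *: dual_poly t p.+1 j =
          \sum_(j < n.+1) b j *: (('X - (t`_j)%:P) * dual_poly t p j).
  rewrite big_ord_recl b0 scale0r add0r.
  by apply: eq_bigr => j _; rewrite dual_polySl.
rewrite -big_split mulr_sumr; apply: eq_bigr => j _ /=.
have jp : (j + p.+1 < size t)%N by have := ltn_ord j; lia.
have := bspline_sign st xt jp; case: ifP => [/andP[h h'] _|_ B0]; last first.
  by rewrite /a /b B0 !mulr0 !scale0r mulr0 addr0.
rewrite /a /b dual_polySr; set A := t`_j; set B := t`_(j + p.+1).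
set N := bspline _ _ _ _; set P := dual_poly _ _ _.
have BA : B - A != 0 by rewrite subr_eq0 gt_eqF // (lt_trans h).
rewrite -!mul_polyC.
have -> : x%:P = ((x - A) / (B - A))%:P * B%:P + ((B - x) / (B - A))%:P * A%:P :> {poly R}.
  by rewrite -!polyCM -polyCD; congr (_%:P); field.
have X1 : ((x - A) / (B - A))%:P + ((B - x) / (B - A))%:P = 1 :> {poly R}.
  by rewrite -polyCD -[1]/(1%:P); congr (_%:P); field.
rewrite -[X in X - (_ + _)]mul1r -X1 !polyCM; ring.
Qed.

Lemma partition_of_unity t p n x : sorted <=%R t -> x \notin t ->
  (n + p < size t)%N -> t`_p < x < t`_n ->
  \sum_(j < n) bspline t p j x = 1.
Proof.
move=> st xt hn hx; have := congr1 (fun q : {poly R} => q`_p) (marsden st xt hn hx).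
have mo : ('X - x%:P) ^+ p \is monic by rewrite monic_exp // monicXsubC.
have := monicP mo; rewrite /lead_coef size_exp_XsubC /= => -> ->.
by rewrite coef_sum; apply: eq_bigr => j _; rewrite coefZ lead_dual_poly mulr1.
Qed.

End UnivariateSplines.

Section LocalIndependence.
Context (R : realType).
Implicit Types (t : seq R) (x y : R) (p j : nat).

Lemma index_bound n p s j : (n + p < s)%N -> (j < n)%N -> (j + p.+1 < s)%N.
Proof. lia. Qed.

(** When x is not a knot: x and y lie in the same open knot interval. *)
Definition unseparated t x y :=
  forall u, u \in t -> (u < y) = (u < x) /\ (y < u) = (x < u).

Lemma unseparated_notin t x y : unseparated t x y -> x \notin t -> y \notin t.
Proof.
move=> h xt; apply/negP => yt; have [] := h y yt; rewrite ltxx.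
move=> /esym/negbT; rewrite -leNgt => xy /esym/negbT; rewrite -leNgt => yx.
by move: xt; rewrite (@le_anti _ _ x y) ?yt // xy yx.
Qed.

Lemma unseparated_between t x y i j : unseparated t x y ->
  (i < size t)%N -> (j < size t)%N ->
  (t`_i < y < t`_j) = (t`_i < x < t`_j).
Proof. by move=> h it jt; rewrite (h _ (mem_nth _ it)).1 (h _ (mem_nth _ jt)).2. Qed.

Lemma unseparated_bspline t p j x y : sorted <=%R t -> x \notin t ->
  unseparated t x y -> (j + p.+1 < size t)%N ->
  (bspline t p j y != 0) = (bspline t p j x != 0).
Proof.
move=> st xt h jt; rewrite !bspline_neq0 //; last exact: unseparated_notin h xt.
by rewrite (unseparated_between h) //; lia.
Qed.

Lemma poly_interval_eq0 (q : {poly R}) (a b : R) : a < b ->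
  (forall x, a < x < b -> q.[x] = 0) -> q = 0.
Proof.
move=> ab q0; apply/eqP/negPn/negP => qn0.
pose f i : R := a + (b - a) / i.+2%:R.
have fI : injective f.
  move=> i j /addrI /(mulfI _); rewrite subr_eq0 gt_eqF // => /(_ isT) /invr_inj.
  by move=> /eqP; rewrite eqr_nat => /eqP [].
have := @max_poly_roots _ q (mkseq f (size q)) qn0.
rewrite mkseq_uniq // size_mkseq ltnn => h; suff: false by []; apply: h => //.
apply/allP => _ /mapP[i _ ->]; apply/rootP/q0.
have ba : 0 < b - a by rewrite subr_gt0.
rewrite ltrDl divr_gt0 ?ltr0n //= -ltrBrDl ltr_pdivrMr ?ltr0n //.
by rewrite ltr_pMr // ltr1n.
Qed.

Lemma coef_exp_XsubC p y k : (k <= p)%N ->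
  (('X - y%:P) ^+ p)`_k = (- y) ^+ (p - k) *+ 'C(p, k).
Proof.
move=> kp; rewrite addrC -polyCN exprDn coef_sum.
have ks : (k < p.+1)%N by [].
rewrite (bigD1 (Ordinal ks)) //= big1 => [|i ik].
  by rewrite addr0 coefMn -rmorphXn coefCM coefXn eqxx mulr1.
rewrite coefMn -rmorphXn coefCM coefXn eq_sym.
by rewrite -val_eqE /= in ik; rewrite (negbTE ik) mulr0 mul0rn.
Qed.

Lemma knot_interval t p n x : x \notin t -> (n < size t)%N -> t`_p < x < t`_n ->
  (p < n)%N -> exists2 r, (p <= r < n)%N & t`_r < x < t`_r.+1.
Proof.
move=> xt; elim: n => // n IH nt /andP[hp hn] pn.
have [nx|xn] := ltP t`_n x; first by exists n; rewrite ?nx // ltnSn -ltnS pn.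
have {}xn : x < t`_n by rewrite knot_ltN // 1?ltnW // -leNgt.
have pn' : (p < n)%N.
  rewrite ltn_neqAle -ltnS pn andbT; apply/eqP => e.
  by move: hp; rewrite e ltNge (ltW xn).
have [||r /andP[pr rn] hr] := IH _ _ pn'; [exact: ltnW | by rewrite hp |].
by exists r => //; rewrite pr ltnW.
Qed.

(** The supports of the other B-splines end at or before the knot of index r
    or start at or after that of index r + 1. *)
Lemma sum_local (V : lmodType R) t p n r y (v : nat -> V) : sorted <=%R t ->
  y \notin t -> (n + p < size t)%N -> (p <= r < n)%N -> t`_r < y < t`_r.+1 ->
  \sum_(j < n) bspline t p j y *: v j =
  \sum_(i < p.+1) bspline t p (i + (r - p)) y *: v (i + (r - p))%N.
Proof.
move=> st yt nt /andP[pr rn] /andP[ry yr].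
have out j : (j < n)%N -> (j < r - p)%N || (r < j)%N -> bspline t p j y = 0.
  move=> jn h; have jt : (j + p.+1 < size t)%N by lia.
  apply/eqP; rewrite -[_ == _]negbK bspline_neq0 //; apply/negP => /andP[h1 h2].
  case/orP: h => h.
    have : t`_(j + p.+1) <= t`_r by apply: knots_le => //; lia.
    by rewrite leNgt (lt_trans ry h2).
  have : t`_r.+1 <= t`_j by apply: knots_le => //; lia.
  by rewrite leNgt (lt_trans h1 yr).
rewrite -(big_mkord xpredT (fun j => bspline t p j y *: v j)).
rewrite (@big_cat_nat _ _ _ (r - p)) //=; last by lia.
rewrite (@big_cat_nat _ _ _ r.+1 (r - p)) //=; last by lia.
rewrite big_nat big1 ?add0r => [|j /andP[_ h]]; last by rewrite out ?scale0r ?h //; lia.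
rewrite [X in _ + X]big_nat [X in _ + X]big1 ?addr0 => [|j /andP[h h']]; last first.
  by rewrite out ?scale0r ?h ?orbT.
rewrite -{1}[(r - p)%N]add0n big_addn (_ : (r.+1 - (r - p) = p.+1)%N); last by lia.
by rewrite big_mkord.
Qed.

(** The p + 1 B-splines that live on a knot interval are linearly independent
    there: by Marsden's identity they span the p + 1 monomials, so the square
    matrix of the coefficients of the dual polynomials is invertible. *)
Lemma bspline_local_independence t p n x (c : nat -> R) : sorted <=%R t ->
  x \notin t -> (n + p < size t)%N -> t`_p < x < t`_n ->
  (forall y, unseparated t x y -> \sum_(j < n) c j * bspline t p j y = 0) ->
  forall j, (j < n)%N -> bspline t p j x != 0 -> c j = 0.
Proof.
move=> st xt nt hx c0.
have pn : (p < n)%N.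
  rewrite ltnNge; apply/negP => np; case/andP: hx => h1 h2.
  have : t`_n <= t`_p by apply: knots_le => //; lia.
  by rewrite leNgt (lt_trans h1 h2).
have nts : (n < size t)%N by lia.
have [r /andP[pr rn] /andP[rx xr]] := knot_interval xt nts hx pn.
have rt : (r.+1 < size t)%N by lia.
have cell_in y : t`_r < y < t`_r.+1 -> unseparated t x y.
  move=> /andP[ry yr] u /(nthP 0)[i it <-].
  case: (leqP i r) => ir.
    have le : t`_i <= t`_r by apply: knots_le => //; exact: ltnW.
    by rewrite !(le_lt_trans le) // ![_ < t`_i]ltNge !(ltW (le_lt_trans le _)).
  have le : t`_r.+1 <= t`_i by apply: knots_le.
  by rewrite !(lt_le_trans _ le) // ![t`_i < _]ltNge !(ltW (lt_le_trans _ le)).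
have cell_notin y : t`_r < y < t`_r.+1 -> y \notin t.
  by move=> /cell_in /unseparated_notin; apply.
have cell_range y : t`_r < y < t`_r.+1 -> t`_p < y < t`_n.
  by move=> /cell_in h; rewrite (unseparated_between h) //; lia.
have covers j : (j < n)%N -> bspline t p j x != 0 ->
    (j - (r - p) < p.+1)%N /\ (r - p <= j)%N.
  move=> jn; rewrite bspline_neq0 //; last exact: index_bound jn.
  move=> /andP[h1 h2].
  have jr : (j <= r)%N.
    rewrite leqNgt; apply/negP => h; have : t`_r.+1 <= t`_j by apply: knots_le => //; lia.
    by rewrite leNgt (lt_trans h1 xr).
  have rj : (r < j + p.+1)%N.
    rewrite ltnNge; apply/negP => h; have : t`_(j + p.+1) <= t`_r by apply: knots_le => //; lia.
    by rewrite leNgt (lt_trans rx h2).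
  by split; clear - jr rj pr; lia.
pose A := \matrix_(k < p.+1, i < p.+1) (dual_poly t p (i + (r - p)))`_k : 'M[R]_p.+1.
pose v y := \col_(i < p.+1) bspline t p (i + (r - p)) y : 'cV[R]_p.+1.
pose mono y := \col_(k < p.+1) (('X - y%:P) ^+ p)`_k : 'cV[R]_p.+1.
have Av y : t`_r < y < t`_r.+1 -> mono y = A *m v y.
  move=> hy; apply/matrixP => k z; rewrite !mxE.
  rewrite (marsden st (cell_notin _ hy) nt (cell_range _ hy)).
  rewrite (sum_local _ st (cell_notin _ hy) nt _ hy) ?pr // coef_sum.
  by apply: eq_bigr => i _; rewrite !mxE coefZ mulrC.
(* Up to nonzero factors, the entries of mono y are the powers of - y. *)
have mono0 (u : 'rV[R]_p.+1) :
    (forall y, t`_r < y < t`_r.+1 -> u *m mono y = 0) -> u = 0.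
  move=> um.
  pose q := \poly_(i < p.+1) (u 0 (rev_ord (inord i)) *+ 'C(p, p - i)).
  have q0 : q = 0.
    apply: (@poly_interval_eq0 q (- t`_r.+1) (- t`_r)).
      by rewrite ltrN2 (lt_trans rx).
    move=> z /andP[z1 z2].
    have hz : t`_r < - z < t`_r.+1 by rewrite ltrNr z2 ltrNl.
    have := congr1 (fun M : 'M[R]_1 => M 0 0) (um _ hz); rewrite !mxE => <-.
    rewrite horner_poly (reindex_inj rev_ord_inj) /=.
    apply: eq_bigr => k _; rewrite !mxE coef_exp_XsubC -1?ltnS // opprK.
    have kp : (k <= p)%N by rewrite -ltnS.
    rewrite subSS subKn // mulrnAl mulrnAr; congr (_ *+ _).
    congr (u _ _ * _); apply: val_inj; rewrite /= inordK ?ltnS ?leq_subr //.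
    by rewrite subSS subKn.
  apply/matrixP => z k; rewrite ord1 mxE.
  have kp : (k <= p)%N by rewrite -ltnS.
  have := congr1 (fun q : {poly R} => q`_(p - k)) q0.
  rewrite coef_poly coef0 ltnS leq_subr subKn // => /eqP.
  rewrite mulrn_eq0 -[_ == 0%N]negbK -lt0n bin_gt0 kp /= => /eqP.
  by congr (u _ _ = _); apply: val_inj; rewrite /= inordK ?ltnS ?leq_subr // subSS subKn.
have Au : A \in unitmx.
  rewrite -row_free_unit -kermx_eq0; apply/eqP/row_matrixP => i; rewrite row0.
  apply: mono0 => y /Av ->; rewrite mulmxA.
  by rewrite -row_mul mulmx_ker row0 mul0mx.
pose cr := \row_(i < p.+1) c (i + (r - p))%N.
have cr0 : cr = 0.
  rewrite -[cr](mulmxKV Au) (mono0 (cr *m invmx A)) ?mul0mx // => y hy.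
  rewrite Av // mulmxA mulmxKV //; apply/matrixP => z z'; rewrite !mxE.
  rewrite -[RHS](c0 y (cell_in _ hy)).
  transitivity (\sum_(j < n) bspline t p j y *: (c j : R^o)); last first.
    by apply: eq_bigr => j _; rewrite mulrC.
  rewrite (sum_local _ st (cell_notin _ hy) nt _ hy) ?pr //.
  by apply: eq_bigr => i _; rewrite !mxE mulrC.
move=> j jn /(covers j jn)[ip jr].
have := congr1 (fun M : 'rV[R]_p.+1 => M 0 (Ordinal ip)) cr0; rewrite !mxE /=.
by rewrite subnK.
Qed.

(** The sum of the coarse B-splines that are nonzero at x equals 1 near x, so
    that the coefficient in it of the given fine B-spline is 1, by the local
    independence near x. If all these coarse B-splines vanished at y, the sum
    would be 0 near y, and the independence near y would make the same
    coefficient 0. *)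
Lemma coarse_bspline_covers (tc tf : seq R) p nc nf x y j0 :
  sorted <=%R tc -> sorted <=%R tf -> {subset tc <= tf} ->
  x \notin tf -> y \notin tf ->
  (nc + p < size tc)%N -> (nf + p < size tf)%N ->
  tc`_p < x < tc`_nc -> tf`_p < x < tf`_nf -> tf`_p < y < tf`_nf ->
  (forall j, (j < nc)%N -> exists C : nat -> R, forall z,
     bspline tc p j z = \sum_(i < nf) C i * bspline tf p i z) ->
  (j0 < nf)%N -> bspline tf p j0 x != 0 -> bspline tf p j0 y != 0 ->
  exists j, [/\ (j < nc)%N, bspline tc p j x != 0 & bspline tc p j y != 0].
Proof.
move=> sc sf cf xf yf hnc hnf hxc hxf hyf nest j0n Nx Ny.
have pf := leq_ltn_trans (leq_addl nf p) hnf.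
have nf' := leq_ltn_trans (leq_addr p nf) hnf.
have pc := leq_ltn_trans (leq_addl nc p) hnc.
have nc' := leq_ltn_trans (leq_addr p nc) hnc.
have xc : x \notin tc by apply: contra xf; apply: cf.
have yc : y \notin tc by apply: contra yf; apply: cf.
have coarse z w : unseparated tf z w -> unseparated tc z w.
  by move=> h u /cf; apply: h.
apply: contrapT => none.
have vanish j : (j < nc)%N -> bspline tc p j x != 0 -> bspline tc p j y = 0.
  by move=> jn jx; apply/eqP/negPn/negP => jy; apply: none; exists j.
(* f is the sum of the coarse B-splines nonzero at x, and D its coefficients
   with respect to the fine ones. *)
pose C (j : 'I_nc) := projT1 (cid (nest j (ltn_ord j))).
have CE (j : 'I_nc) z : bspline tc p j z = \sum_(i < nf) C j i * bspline tf p i z.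
  by rewrite /C; case: cid => /= C' ->.
pose f z := \sum_(j < nc | bspline tc p j x != 0) bspline tc p j z.
pose D i := \sum_(j < nc | bspline tc p j x != 0) C j i.
have fD z : f z = \sum_(i < nf) D i * bspline tf p i z.
  rewrite /f; under eq_bigr do rewrite CE; rewrite exchange_big.
  by apply: eq_bigr => i _; rewrite mulr_suml.
have D0 : D j0 = 0.
  apply: (bspline_local_independence sf yf hnf hyf _ j0n Ny) => z hz.
  rewrite -fD /f big1 // => j jx; apply/eqP; rewrite -[_ == _]negbK.
  have jt := index_bound hnc (ltn_ord j).
  by rewrite (unseparated_bspline sc yc (coarse _ _ hz)) // vanish // eqxx.
have D1 : D j0 - 1 = 0.
  apply: (bspline_local_independence (c := fun i => D i - 1) sf xf hnf hxf _ j0n Nx) => z hz.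
  under eq_bigr do rewrite mulrBl mul1r.
  have zf : z \notin tf by exact: unseparated_notin hz xf.
  rewrite sumrB -fD (partition_of_unity sf zf hnf); last first.
    by rewrite (unseparated_between hz).
  have hzc : tc`_p < z < tc`_nc.
    by rewrite (unseparated_between (coarse _ _ hz)).
  have zc : z \notin tc by apply: contra zf; apply: cf.
  have one := partition_of_unity sc zc hnc hzc.
  rewrite (bigID (fun j : 'I_nc => bspline tc p j x != 0)) /= in one.
  rewrite [X in _ + X]big1 ?addr0 in one; last first.
    move=> j jx; apply/eqP; rewrite -[_ == _]negbK.
    have jt := index_bound hnc (ltn_ord j).
    by rewrite (unseparated_bspline sc xc (coarse _ _ hz)).
  by rewrite /f one subrr.
by move: D1; rewrite D0 sub0r => /eqP; rewrite oppr_eq0 oner_eq0.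
Qed.

End LocalIndependence.

(** * Dyadic grids and their cells *)

Section Bisection.
Context (R : realType).
Implicit Types (z t : seq R) (x : R) (p j : nat).

Lemma size_bisect z : size (bisect z) = (size z).*2.-1.
Proof.
elim: z => // x [|y z] IH //.
by rewrite [bisect _]/= -/(bisect (y :: z)) [LHS]/= -/(bisect (y :: z)) IH.
Qed.

Lemma nth_bisect z j : (j < size z)%N -> (bisect z)`_j.*2 = z`_j.
Proof.
elim: z j => // x [|y z] IH [|j] // hj.
rewrite [bisect _]/= -/(bisect (y :: z)) doubleS /= -/(bisect (y :: z)).
exact: IH.
Qed.

Lemma nth_bisect_mid z j : (j.+1 < size z)%N ->
  (bisect z)`_j.*2.+1 = (z`_j + z`_j.+1) / 2.
Proof.
elim: z j => // x [|y z] IH [|j] // hj.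
rewrite [bisect _]/= -/(bisect (y :: z)) doubleS /= -/(bisect (y :: z)).
exact: IH.
Qed.

Lemma midpoint_between (a b : R) : a < b -> a < (a + b) / 2 < b.
Proof. by move=> ab; rewrite ltr_pdivlMr // ltr_pdivrMr //; lra. Qed.

Lemma breakpoints_bisect z : breakpoints z -> breakpoints (bisect z).
Proof.
move=> [sz hz]; split; last by rewrite size_bisect; lia.
elim: z sz {hz} => // x [|y z] IH // /= /andP[xy yz].
have /andP[h1 h2] := midpoint_between xy.
rewrite -/(bisect (y :: z)) h1 /=; have := IH yz.
by case: z {IH yz} => [|w z] /=; rewrite h2.
Qed.

Lemma mem_bisect z : {subset z <= bisect z}.
Proof.
move=> x /(nthP 0)[j jz <-]; rewrite -nth_bisect //; apply: mem_nth.
by rewrite size_bisect; case: (size z) jz => // n; rewrite ltnS doubleS -leq_double.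
Qed.

Lemma grid_ltn z i j : breakpoints z -> (i < size z)%N -> (j < size z)%N ->
  (z`_i < z`_j) = (i < j)%N.
Proof. by move=> [sz _] iz jz; rewrite (lt_sorted_ltn_nth _ sz). Qed.

Lemma grid_leq z i j : breakpoints z -> (i < size z)%N -> (j < size z)%N ->
  (z`_i <= z`_j) = (i <= j)%N.
Proof. by move=> [sz _] iz jz; rewrite (lt_sorted_leq_nth _ sz). Qed.

Lemma bisect_interval z j x : breakpoints z -> (j.+1 < size (bisect z))%N ->
  (bisect z)`_j < x < (bisect z)`_j.+1 ->
  (j./2.+1 < size z)%N /\ z`_j./2 < x < z`_j./2.+1.
Proof.
move=> bz; rewrite size_bisect => jz hx.
have hj : (j./2.+1 < size z)%N by case: bz => _; move: jz; case: (size z) => [|[]] // n; lia.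
split=> //; have lt : z`_j./2 < z`_j./2.+1 by rewrite grid_ltn // ltnW.
have /andP[m1 m2] := midpoint_between lt.
move: hx m1 m2 hj; move: (odd_double_half j); move: (j./2) => q.
case: (odd j) => <-; rewrite ?add1n ?add0n => + m1 m2 hj.
  rewrite nth_bisect_mid // -doubleS nth_bisect // => /andP[a ->].
  by rewrite (lt_trans m1).
rewrite nth_bisect_mid // nth_bisect // 1?ltnW // => /andP[-> b].
by rewrite (lt_trans b).
Qed.

(** The end knots have multiplicity p + 1, so that every point inside the
    interval lies in the range of the Marsden identity. *)
Lemma open_knot_vector_range p z t x : open_knot_vector p z t ->
  head 0 z < x < last 0 z ->
  (size t - p.+1 + p < size t)%N /\ t`_p < x < t`_(size t - p.+1).
Proof.
move=> [st tz _ ch cl] /andP[hx xl].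
have ps : (p < size t)%N by rewrite -ch count_size.
have it : (size t - p.+1 + p < size t)%N by lia.
split=> //; apply/andP; split; rewrite ltNge; apply/negP => h.
  have : (count_mem (head 0%R z) t <= p)%N; last by rewrite ch ltnn.
  have out : count_mem (head 0 z) (drop p t) = 0%N.
    apply/count_memPn/(nthP 0) => -[i it' e].
    rewrite size_drop ltn_subRL in it'; rewrite nth_drop in e.
    have := knots_le st (leq_addr i p) it'; rewrite e leNgt.
    by rewrite (lt_le_trans hx h).
  rewrite -{1}(cat_take_drop p t) count_cat out addn0.
  by rewrite (leq_trans (count_size _ _)) // size_takel // ltnW.
have : (count_mem (last 0%R z) t <= p)%N; last by rewrite cl ltnn.
have out : count_mem (last 0 z) (take (size t - p) t) = 0%N.
  apply/count_memPn/(nthP 0) => -[i]; rewrite size_takel ?leq_subr // => it' e.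
  rewrite nth_take // in e.
  have := @knots_le _ t i (size t - p.+1) st; rewrite e.
  rewrite leNgt (le_lt_trans h xl) => C; suff : false by [].
  by apply: C; clear - it' ps; lia.
rewrite -{1}(cat_take_drop (size t - p) t) count_cat out add0n.
by rewrite (leq_trans (count_size _ _)) // size_drop subKn // ltnW.
Qed.

(** A point and a B-spline that does not vanish there exist by the partition of
    unity. *)
Lemma open_knot_vector_bspline p z t : breakpoints z -> open_knot_vector p z t ->
  exists a, exists2 j, (j + p.+1 < size t)%N & bspline t p j a != 0.
Proof.
move=> bz ot; have [sz hz] := bz; have [st tz _ _ _] := ot.
have lt01 : z`_0 < z`_1 by rewrite grid_ltn // ltnW.
have /andP[h1 h2] := midpoint_between lt01.
set a := (_ / 2) in h1 h2.
have at0 : a \notin t.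
  rewrite tz; apply/(nthP 0) => -[i iz ia].
  by move: h1 h2; rewrite -ia !grid_ltn // ?(ltnW hz) //; case: i {iz ia}.
have ha : head 0 z < a < last 0 z.
  rewrite -nth0 h1 -nth_last (lt_le_trans h2) // grid_leq //.
    by case: (size z) hz => [|[]].
  by rewrite ltn_predL ltnW.
have [ht hr] := open_knot_vector_range ot ha.
have := partition_of_unity st at0 ht hr.
have [/existsP[j Nj] _|none] := boolP [exists j : 'I_(size t - p.+1), bspline t p j a != 0].
  by exists a, j => //; have := ltn_ord j; lia.
rewrite big1 => [/eqP|j _]; first by rewrite eq_sym oner_eq0.
by apply/eqP; move/existsPn: none => /(_ j); rewrite negbK.
Qed.

End Bisection.

Section Cells.
Context (R : realType) (d : nat) (S : spline_data R d).
Hypothesis hS : nested_spline_spaces S.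
Notation point := 'rV[R]_d.
Implicit Types (l k : nat) (i : 'I_d) (x y : point) (P Q : set point).

Let hbreaks i : breakpoints (breaks S i). Proof. by case: hS. Qed.

Lemma breakpoints_grid l i : breakpoints (grid S l i).
Proof. by elim: l => //= l IH; apply: breakpoints_bisect. Qed.

Definition box l (j : 'I_d -> nat) : set point := [set x |
  forall i, (grid S l i)`_(j i) < x 0 i < (grid S l i)`_(j i).+1].

Lemma cell_disjoint l P Q x : cell S l P -> cell S l Q -> P x -> Q x -> P = Q.
Proof.
move=> [j hj ->] [j' hj' ->] Px Qx; suff -> : j = j' by [].
apply/funext => i; have /andP[a b] := Px i; have /andP[a' b'] := Qx i.
have bi := breakpoints_grid l i.
have := lt_trans a b'; have := lt_trans a' b; have := hj i; have := hj' i.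
by move=> h h'; rewrite !grid_ltn ?(ltnW h) ?(ltnW h') //; lia.
Qed.

Lemma cell_nonempty l Q : cell S l Q -> Q !=set0.
Proof.
move=> [j hj ->]; exists (\row_i (((grid S l i)`_(j i) + (grid S l i)`_(j i).+1) / 2)).
move=> i; rewrite mxE; apply: midpoint_between.
by rewrite grid_ltn ?(ltnW (hj i)) ?hj //; exact: breakpoints_grid.
Qed.

Lemma cell_open l Q : cell S l Q -> open Q.
Proof.
move=> [j hj ->]; rewrite openE => x hx; rewrite /interior /=.
apply: (@filter_forall _ _ (fun i => [set y : point |
  (grid S l i)`_(j i) < y 0 i < (grid S l i)`_(j i).+1]) (nbhs x)) => i.
have /andP[h1 h2] := hx i.
have c := @coord_continuous R 1 d 0 i x.
have L : \forall y \near nbhs x, (grid S l i)`_(j i) < (y : point) 0 i := c _ (lt_nbhsr h1).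
have U : \forall y \near nbhs x, (y : point) 0 i < (grid S l i)`_(j i).+1 := c _ (lt_nbhsl h2).
by near=> y; apply/andP; split; near: y.
Unshelve. all: by end_near.
Qed.

Lemma cell_meets_closure l Q (A : set point) : cell S l Q ->
  closure A `&` Q !=set0 -> A `&` Q !=set0.
Proof. by move=> /cell_open oQ [x [cA Qx]]; apply: cA; apply: open_nbhs_nbhs. Qed.

Lemma cell_parent l Q : cell S l.+1 Q -> exists2 P, cell S l P & Q `<=` P.
Proof.
move=> [j hj ->].
exists (box l (fun i => (j i)./2)).
  exists (fun i => (j i)./2) => // i.
  have [x /(_ i)] := cell_nonempty (ex_intro2 _ _ j hj erefl).
  by case/(bisect_interval (breakpoints_grid l i) (hj i)).
by move=> x hx i; case: (bisect_interval (breakpoints_grid l i) (hj i) (hx i)).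
Qed.

Lemma cell_child l P : cell S l P -> exists2 Q, cell S l.+1 Q & Q `<=` P.
Proof.
move=> [j hj ->].
exists (box l.+1 (fun i => (j i).*2)).
  exists (fun i => (j i).*2) => // i.
  by have := hj i; rewrite /grid /= size_bisect; lia.
move=> x hx i; have := hx i; have h := hj i.
have lt : (grid S l i)`_(j i) < (grid S l i)`_(j i).+1.
  by rewrite grid_ltn // 1?ltnW //; exact: breakpoints_grid.
have /andP[m1 m2] := midpoint_between lt.
rewrite /grid /= -/(grid S l i) nth_bisect_mid // nth_bisect // 1?ltnW //.
by move=> /andP[-> b]; rewrite (lt_trans b).
Qed.

(** A child misses the center of its parent. *)
Lemma cell_child_neq l P : (0 < d)%N -> cell S l P -> ~ cell S l.+1 P.
Proof.
move=> d0 [j hj ->] [j' hj' e].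
pose c : point := \row_i (((grid S l i)`_(j i) + (grid S l i)`_(j i).+1) / 2).
have : box l j c.
  move=> i; rewrite mxE; apply: midpoint_between.
  by rewrite grid_ltn ?(ltnW (hj i)) ?hj //; exact: breakpoints_grid.
rewrite (e : box l j = box l.+1 j') => /(_ (Ordinal d0)); set i := Ordinal d0.
rewrite mxE -nth_bisect_mid ?hj //.
have bi := breakpoints_grid l.+1 i; rewrite /grid /= -/(grid S l i) in bi *.
have := hj i; have := hj' i; rewrite /grid /= -/(grid S l i) => h' h.
rewrite !grid_ltn // ?size_bisect; rewrite ?size_bisect in h'; lia.
Qed.

Lemma cell_ancestor k l Q : (k <= l)%N -> cell S l Q ->
  exists2 P, cell S k P & Q `<=` P.
Proof.
move=> /subnK <-; elim: (l - k)%N Q => [|n IH] Q; first by exists Q.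
move=> /cell_parent[P /IH[P' cP' PP'] QP]; exists P' => //; exact: subset_trans PP'.
Qed.

Lemma cell_sub_of_meets k l P Q x : (k <= l)%N -> cell S k P -> cell S l Q ->
  P x -> Q x -> Q `<=` P.
Proof.
move=> kl cP cQ Px Qx; have [P' cP' QP'] := cell_ancestor kl cQ.
by rewrite (cell_disjoint cP cP' Px (QP' _ Qx)).
Qed.

Lemma cell_level_unique k l Q : (0 < d)%N -> cell S k Q -> cell S l Q -> k = l.
Proof.
move=> d0; wlog kl : k l / (k <= l)%N.
  by move=> h ck cl; case/orP: (leq_total k l) => kl; [|symmetry]; apply: h.
move=> ck cl; move: kl; rewrite leq_eqVlt => /orP[/eqP //|kl].
have [P cP QP] := cell_ancestor kl cl; have [x Qx] := cell_nonempty cl.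
have PQ := cell_sub_of_meets (leqnSn k) ck cP Qx (QP _ Qx).
by case: (cell_child_neq d0 ck); rewrite (_ : Q = P) //; apply/seteqP.
Qed.

Lemma finite_cells l : finite_set (cell S l).
Proof.
pose N := (\max_i size (grid S l i))%N.
have fin : finite_set [set: {ffun 'I_d -> 'I_N.+1}] by exact: finite_finset.
apply: (sub_finite_set _ (finite_image (fun j : {ffun 'I_d -> 'I_N.+1} => box l (fun i => j i)) fin)) => _ [j hj ->].
exists [ffun i => inord (j i)] => //.
apply/seteqP; split=> x hx i; have := hx i; rewrite ffunE inordK // ltnS;
  by rewrite (leq_trans _ (leq_bigmax i)) // ltnW // ltnW.
Qed.

End Cells.

(** * Tensor-product B-splines on cells *)

Section GridIntervals.
Context (R : realType).
Implicit Types (z t : seq R) (x y : R).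

Lemma interval_notin z j x : breakpoints z -> (j.+1 < size z)%N ->
  z`_j < x < z`_j.+1 -> x \notin z.
Proof.
move=> bz jz /andP[h1 h2]; apply/(nthP 0) => -[i iz e].
by move: h1 h2; rewrite -e !(grid_ltn bz) ?(ltnW jz) // => h; rewrite ltnS leqNgt h.
Qed.

Lemma interval_unseparated z j x y : breakpoints z -> (j.+1 < size z)%N ->
  z`_j < x < z`_j.+1 -> z`_j < y < z`_j.+1 -> unseparated z x y.
Proof.
move=> bz jz /andP[x1 x2] /andP[y1 y2] _ /(nthP 0)[i iz <-].
case: (leqP i j) => ij.
  have le : z`_i <= z`_j by rewrite (grid_leq bz) ?(ltnW jz).
  by rewrite !(le_lt_trans le) // ![_ < z`_i]ltNge !(ltW (le_lt_trans le _)).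
have le : z`_j.+1 <= z`_i by rewrite grid_leq.
by rewrite !(lt_le_trans _ le) // ![z`_i < _]ltNge !(ltW (lt_le_trans _ le)).
Qed.

Lemma interval_range z j x : breakpoints z -> (j.+1 < size z)%N ->
  z`_j < x < z`_j.+1 -> head 0 z < x < last 0 z.
Proof.
move=> bz jz /andP[h1 h2]; rewrite -nth0 -nth_last.
rewrite (le_lt_trans _ h1) ?grid_leq // ?(leq_ltn_trans _ jz) //=.
rewrite (lt_le_trans h2) // grid_leq //; first by case: (size z) jz.
by rewrite ltn_predL (leq_ltn_trans _ jz).
Qed.

End GridIntervals.

Section Basis.
Context (R : realType) (d : nat) (S : spline_data R d).
Hypothesis hS : nested_spline_spaces S.
Notation point := 'rV[R]_d.
Implicit Types (l k : nat) (i : 'I_d) (x y : point) (P Q : set point).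

Let hknots l i : open_knot_vector (degree S i) (grid S l i) (knots S l i).
Proof. by case: hS. Qed.

Let sorted_knots l i : sorted <=%R (knots S l i).
Proof. by case: (hknots l i). Qed.

Let mem_knots l i : knots S l i =i grid S l i.
Proof. by case: (hknots l i). Qed.

Lemma cell_notin_knots l Q x i : cell S l Q -> Q x -> x 0 i \notin knots S l i.
Proof.
move=> [j hj ->] /(_ i) hx; rewrite mem_knots.
exact: interval_notin (breakpoints_grid hS l i) (hj i) hx.
Qed.

Lemma cell_unseparated l Q x y i : cell S l Q -> Q x -> Q y ->
  unseparated (knots S l i) (x 0 i) (y 0 i).
Proof.
move=> [j hj ->] /(_ i) hx /(_ i) hy u; rewrite mem_knots.
exact: (interval_unseparated (breakpoints_grid hS l i) (hj i) hx hy).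
Qed.

Lemma cell_knot_range l Q x i : cell S l Q -> Q x ->
  (size (knots S l i) - (degree S i).+1 + degree S i < size (knots S l i))%N /\
  (knots S l i)`_(degree S i) < x 0 i <
    (knots S l i)`_(size (knots S l i) - (degree S i).+1).
Proof.
move=> [j hj ->] /(_ i) hx; apply: open_knot_vector_range (hknots l i) _.
exact: interval_range (breakpoints_grid hS l i) (hj i) hx.
Qed.

(** No knot separates two points of a cell, in any direction. *)
Lemma basis_neq0_cell l beta Q x y : basis S l beta -> cell S l Q ->
  Q x -> Q y -> beta x != 0 -> beta y != 0.
Proof.
move=> [j hj ->] cQ Qx Qy /prodf_neq0 h; apply/prodf_neq0 => i _.
rewrite (unseparated_bspline _ _ (@cell_unseparated l Q x y i cQ Qx Qy)) //.
  exact: h.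
exact: cell_notin_knots cQ Qx.
Qed.

(** The nestedness of the spaces in d variables is inherited by those in one
    variable: restrict to a line on which the other factors of a tensor-product
    B-spline are nonzero constants. *)
Lemma bspline_nested l i j :
  (j + (degree S i).+1 < size (knots S l i))%N ->
  exists C : nat -> R, forall z, bspline (knots S l i) (degree S i) j z =
    \sum_(k < size (knots S l.+1 i) - (degree S i).+1)
       C k * bspline (knots S l.+1 i) (degree S i) k z.
Proof.
move=> hj; set n := (_ - _)%N; set p := degree S i.
pose spanned (g : R -> R) := exists C : nat -> R, forall z,
  g z = \sum_(k < n) C k * bspline (knots S l.+1 i) p k z.
have spanned0 : spanned (fun=> 0).
  by exists (fun=> 0) => z; rewrite big1 // => k _; rewrite mul0r.
have spannedD f g : spanned f -> spanned g -> spanned (fun z => f z + g z).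
  move=> [C fC] [D gD]; exists (fun k => C k + D k) => z.
  by rewrite fC gD -big_split; apply: eq_bigr => k _; rewrite mulrDl.
have spannedZ a g : spanned g -> spanned (fun z => a * g z).
  move=> [C gC]; exists (fun k => a * C k) => z.
  by rewrite gC mulr_sumr; apply: eq_bigr => k _; rewrite mulrA.
have spanned1 k : (k + p.+1 < size (knots S l.+1 i))%N ->
    spanned (bspline (knots S l.+1 i) p k).
  move=> hk; have kn : (k < n)%N by rewrite /n ltn_subRL addnC.
  exists (fun k' => (k' == k)%:R) => z; rewrite (bigD1 (Ordinal kn)) //= eqxx mul1r.
  rewrite big1 ?addr0 // => k' kk'; rewrite -val_eqE /= in kk'.
  by rewrite (negbTE kk') mul0r.
have /(_ _)/cid/= ex i' := open_knot_vector_bspline (breakpoints_grid hS l i') (hknots l i').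
pose a i' := projT1 (ex i').
pose jj i' := if i' == i then j else s2val (cid2 (projT2 (ex i'))).
have hjj i' : (jj i' + (degree S i').+1 < size (knots S l i'))%N.
  by rewrite /jj; case: eqP => [->//|_]; exact: (s2valP (cid2 (projT2 (ex i')))).
pose line z : point := \row_i' if i' == i then z else a i'.
have prod_line (t : 'I_d -> seq R) (e : 'I_d -> nat) z :
    \prod_i' bspline (t i') (degree S i') (e i') (line z 0 i') =
    (\prod_(i' | i' != i) bspline (t i') (degree S i') (e i') (a i')) *
    bspline (t i) p (e i) z.
  rewrite (bigD1 i) //= mulrC mxE eqxx; congr (_ * _).
  by apply: eq_bigr => i' /negbTE ii'; rewrite mxE ii'.
pose f x := \prod_i' bspline (knots S l i') (degree S i') (jj i') (x 0 i').
have : spline_space S l f.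
  exists 1%N, (fun=> 1), (fun=> f); split; first by move=> _; exists jj.
  by apply/funext => x; rewrite big_ord1 mul1r.
case: hS => _ _ /(_ l) sub /sub [m [c [beta [hb fE]]]].
have spanned_f : spanned (f \o line).
  rewrite (_ : _ \o _ = fun z => \sum_(k < m) c k * beta k (line z)); last first.
    by apply/funext => z; rewrite fE.
  elim: m c beta hb {fE} => [|m IH] c beta hb.
    under eq_fun do rewrite big_ord0.
    exact: spanned0.
  under eq_fun do rewrite big_ord_recr.
  apply: spannedD.
    pose w := widen_ord (leqnSn m).
    exact: (IH (c \o w) (beta \o w) (fun o => hb (w o))).
  have [e he ->] := hb ord_max.
  under eq_fun do rewrite prod_line.
  by apply: (spannedZ _ _ (spannedZ _ _ (spanned1 _ _))).
pose K := \prod_(i' | i' != i) bspline (knots S l i') (degree S i') (jj i') (a i').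
have K0 : K != 0.
  apply/prodf_neq0 => i' /negbTE ii'; rewrite /jj ii'.
  exact: (s2valP' (cid2 (projT2 (ex i')))).
have [C gC] := spannedZ K^-1 _ spanned_f; exists C => z; rewrite -gC /= /f prod_line.
by rewrite mulrA mulVf // mul1r /jj eqxx.
Qed.

(** The factors of a tensor-product B-spline are independent of each other, so
    the univariate result applies in each direction. *)
Lemma basis_coarsen l beta P Q x y : basis S l.+1 beta ->
  cell S l.+1 P -> cell S l.+1 Q -> P x -> Q y -> beta x != 0 -> beta y != 0 ->
  exists2 beta', basis S l beta' & beta' x != 0 /\ beta' y != 0.
Proof.
move=> [j hj ->] cP cQ Px Qy /prodf_neq0 bx /prodf_neq0 bY.
have ex i : exists k, [/\ (k + (degree S i).+1 < size (knots S l i))%N,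
    bspline (knots S l i) (degree S i) k (x 0 i) != 0 &
    bspline (knots S l i) (degree S i) k (y 0 i) != 0].
  have [P' cP' PP'] := cell_parent hS cP.
  have [Q' cQ' QQ'] := cell_parent hS cQ.
  have [nf fx] := @cell_knot_range l.+1 P x i cP Px.
  have [_ fy] := @cell_knot_range l.+1 Q y i cQ Qy.
  have [nc cx] := @cell_knot_range l P' x i cP' (PP' _ Px).
  have sub : {subset knots S l i <= knots S l.+1 i}.
    by move=> u; rewrite !mem_knots; exact: mem_bisect.
  have nest k : (k < size (knots S l i) - (degree S i).+1)%N -> _ :=
    fun h => @bspline_nested l i k (index_bound nc h).
  have jn : (j i < size (knots S l.+1 i) - (degree S i).+1)%N.
    by rewrite ltn_subRL addnC.
  have [k [kn kx ky]] := coarse_bspline_covers (sorted_knots l i)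
    (sorted_knots l.+1 i) sub (cell_notin_knots i cP Px) (cell_notin_knots i cQ Qy)
    nc nf cx fx fy nest jn (bx i isT) (bY i isT).
  by exists k; split=> //; exact: index_bound nc kn.
pose e i := projT1 (cid (ex i)).
have he i := projT2 (cid (ex i)).
exists (fun x : point => \prod_i bspline (knots S l i) (degree S i) (e i) (x 0 i)).
  by exists e => // i; case: (he i).
by split; apply/prodf_neq0 => i _; case: (he i).
Qed.

End Basis.

(** * Hierarchies of domains *)

Section Hierarchies.
Context (R : realType) (d : nat) (S : spline_data R d).
Hypothesis hS : nested_spline_spaces S.
Notation point := 'rV[R]_d.
Implicit Types (H : hierarchy R d) (l k : nat) (x y : point) (P Q : set point).

Lemma union_of_cells_sub k l (A : set point) Q x : union_of_cells S k A ->
  (k <= l)%N -> cell S l Q -> A x -> Q x -> Q `<=` A.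
Proof.
move=> [C CS ->] kl cQ [P CP Px] Qx.
have [y [Py Qy]] : P `&` Q !=set0.
  by apply: (cell_meets_closure cQ); exists x.
apply: (subset_trans (cell_sub_of_meets hS kl (CS _ CP) cQ Py Qy)).
by apply: (subset_trans (@subset_closure _ P)) => z Pz; exists P.
Qed.

Lemma dom_cell_sub H l k Q x : domain_hierarchy S H -> (l <= k.+1)%N ->
  cell S k Q -> dom H l x -> Q x -> Q `<=` dom H l.
Proof.
move=> [_ _ _ _ [u0 uS]]; case: l => [|l] lk.
  exact: (union_of_cells_sub u0).
exact: (union_of_cells_sub (uS l)).
Qed.

Lemma dom_le H l k : domain_hierarchy S H -> (l <= k)%N -> dom H k `<=` dom H l.
Proof.
move=> [_ hsub _ _ _] /subnK <-; elim: (k - l)%N => // n IH.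
exact: subset_trans (hsub _) IH.
Qed.

Lemma closure_dom_sub H l Q : domain_hierarchy S H -> Q `<=` dom H l ->
  closure Q `<=` dom H l.
Proof. by move=> [_ _ _ cl _] Ql; rewrite (closure_id (dom H l)).1 //; exact: closureS. Qed.

(** Since the domain of level l + 1 consists of cells of level l, it contains
    an element or misses it. *)
Lemma activeE H l Q : domain_hierarchy S H ->
  active S H l Q <-> [/\ cell S l Q, Q `<=` dom H l & ~ Q `<=` dom H l.+1].
Proof.
move=> hH; split=> [[cQ Ql none]|[cQ Ql Ql1]]; split=> //.
  move=> Ql1; have [Q' cQ' Q'Q] := cell_child hS cQ; apply: none.
  by exists l.+1, Q'; split=> //; exact: subset_trans Ql1.
move=> [l' [Q' [ll' cQ' Q'l' Q'Q]]]; apply: Ql1.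
have [x Q'x] := cell_nonempty hS cQ'.
exact: (dom_cell_sub hH (leqnn _) cQ (dom_le hH ll' (Q'l' _ Q'x)) (Q'Q _ Q'x)).
Qed.

Lemma active_sub_dom0 H l Q : domain_hierarchy S H -> active S H l Q ->
  Q `<=` dom H 0.
Proof. by move=> hH [_ Ql _]; apply: subset_trans Ql _; exact: dom_le. Qed.

Definition extends H H' :=
  dom H' 0 = dom H 0 /\ forall l, dom H l `<=` dom H' l.

Lemma extends_refl H : extends H H.
Proof. by split=> // l; exact: subset_refl. Qed.

Lemma extends_trans H1 H2 H3 : extends H1 H2 -> extends H2 H3 -> extends H1 H3.
Proof.
move=> [e s] [e' s']; split; first by rewrite e'.
by move=> l; exact: subset_trans (s' l).
Qed.

(** If the descent from level 0 to the given cell leaves the domains of H, the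
    last cell before that is active in H. *)
Lemma cell_in_dom_or_below_active H l Q : domain_hierarchy S H -> cell S l Q ->
  Q `<=` dom H 0 -> Q `<=` dom H l \/
    exists2 P, param_mesh S H P & clos_trans _ (dyadic_child S) Q P.
Proof.
move=> hH; elim: l Q => [|l IH] Q cQ Q0; first by left.
have [P cP QP] := cell_parent hS cQ; have [x Qx] := cell_nonempty hS cQ.
have P0 : P `<=` dom H 0 := dom_cell_sub hH (leq0n _) cP (Q0 _ Qx) (QP _ Qx).
have child : dyadic_child S Q P by exists l.
case: (IH P cP P0) => [Pl|[P' aP' PP']]; last first.
  by right; exists P' => //; apply: t_trans PP'; apply: t_step.
have [Pl1|Pl1] := pselect (P `<=` dom H l.+1).
  by left; exact: subset_trans Pl1.
right; exists P; last exact: t_step.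
by exists l => //; apply/(activeE _ _ hH).
Qed.

Lemma extends_refinement H H' : domain_hierarchy S H -> domain_hierarchy S H' ->
  extends H H' -> refinement S H' H.
Proof.
move=> hH hH' [e0 sub] Q [l _ aQ].
have Q0 : Q `<=` dom H 0 by rewrite -e0; exact: active_sub_dom0 aQ.
move/(activeE _ _ hH'): aQ => [cQ Ql Ql1].
case: (cell_in_dom_or_below_active hH cQ Q0) => [QHl|]; last by right.
left; exists l => //; apply/(activeE _ _ hH); split=> // QHl1.
by apply: Ql1; exact: subset_trans (sub _).
Qed.

Lemma support_cell_neq0 H l beta Q x : basis S l beta -> cell S l Q ->
  support H beta `&` Q !=set0 -> Q x -> beta x != 0.
Proof.
move=> bb cQ [y [[cy _] Qy]] Qx.
have [z [bz Qz]] : [set x | beta x != 0] `&` Q !=set0.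
  by apply: (cell_meets_closure cQ); exists y.
exact: (basis_neq0_cell hS bb cQ Qz Qx bz).
Qed.

Lemma cell_support H l beta Q x : cell S l Q -> Q `<=` dom H 0 ->
  (forall y, Q y -> beta y != 0) -> support H beta `&` Q !=set0.
Proof.
move=> cQ Q0 bQ; have [y Qy] := cell_nonempty hS cQ.
by exists y; split=> //; split; [apply: subset_closure; exact: bQ | exact: Q0].
Qed.

Lemma support_extension_dom0 H Q k P : domain_hierarchy S H ->
  support_extension S H Q k P -> P `<=` dom H 0.
Proof.
move=> hH [cP [beta [_ [x [[_ x0] Px]] _]]].
exact: dom_cell_sub hH (leq0n _) cP x0 Px.
Qed.

Lemma support_extension_extends H H' Q k : extends H H' ->
  support_extension S H' Q k = support_extension S H Q k.
Proof. by move=> [e _]; rewrite /support_extension /support e. Qed.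

(** A B-spline of level k that is nonzero somewhere on P is nonzero on all of P,
    hence on Q. *)
Lemma support_extension_descendant H k l P Q : domain_hierarchy S H ->
  cell S k P -> cell S l Q -> Q `<=` P -> Q `<=` dom H 0 ->
  support_extension S H Q k = support_extension S H P k.
Proof.
move=> hH cP cQ QP Q0; apply/seteqP; split=> P' [cP' [beta [bb s1 s2]]];
  split=> //; exists beta; split=> //.
  by case: s2 => x [sx Qx]; exists x; split=> //; exact: QP.
have [x Qx] := cell_nonempty hS cQ.
apply: (cell_support x cQ Q0) => y Qy.
exact: (support_cell_neq0 bb cP s2 (QP _ Qy)).
Qed.

Lemma omega_extends H H' l : domain_hierarchy S H' -> extends H H' ->
  omega S H l `<=` omega S H' l.
Proof.
move=> hH' ext x [Q [cQ sub] Qx]; exists Q => //; split=> //.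
by rewrite (support_extension_extends _ _ ext); apply: subset_trans sub (ext.2 l).
Qed.

Variable m : nat.
Hypothesis hm : (2 <= m)%N.

(** Admissibility puts the support extension of the ancestor of Q of level
    k = l + 1 - m in the domain of that level; for k = 0 this domain is
    everything. The cells of the support extension of Q one level finer have
    their parents in it, as a fine B-spline that links two cells yields a coarse
    one that links their parents. *)
Lemma support_extension_parent H l Q P : domain_hierarchy S H ->
  strictly_admissible S m H -> cell S l Q -> Q `<=` dom H l -> (m <= l.+1)%N ->
  support_extension S H Q (l.+1 - m).+1 P ->
  exists2 P', cell S (l.+1 - m) P' & P `<=` P' /\ P' `<=` dom H (l.+1 - m).
Proof.
move=> hH adm cQ Ql ml SP; have P0 := support_extension_dom0 hH SP.
case: (SP) => cP [beta [bb sP sQ]].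
have [P' cP' PP'] := cell_parent hS cP; exists P' => //; split=> //.
have [x Px] := cell_nonempty hS cP; have [y Qy] := cell_nonempty hS cQ.
have P'0 : P' `<=` dom H 0 := dom_cell_sub hH (leq0n _) cP' (P0 _ Px) (PP' _ Px).
have [e|lm] := eqVneq l.+1 m; first by rewrite e subnn.
have ml' : (m <= l)%N by rewrite -ltnS ltn_neqAle eq_sym lm.
rewrite subSn // in cP cP' bb sP sQ SP *.
set k := (l - m)%N in cP cP' bb sP sQ SP *.
have k1l : (k.+1 <= l)%N by rewrite /k; lia.
have k2l : (k.+2 <= l)%N by rewrite /k; lia.
have ld : (l < depth H)%N.
  rewrite ltnNge; apply/negP => dl; have [_ _ /(_ l dl) e _ _] := hH.
  by have := Ql _ Qy; rewrite e.
(* W and V are the ancestors of Q of levels l + 1 - m and l + 2 - m. *)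
have [W [cW subW] Wy] : omega S H k.+1 y by apply: adm (Ql _ Qy); rewrite ml' ld.
have QW : Q `<=` W.
  have [z [Wz Qz]] : W `&` Q !=set0.
    by apply: (cell_meets_closure cQ); exists y.
  exact: (cell_sub_of_meets hS k1l cW cQ Wz Qz).
have [V cV QV] := cell_ancestor hS k2l cQ.
have VW : V `<=` W := cell_sub_of_meets hS (leqnSn _) cW cV (QW _ Qy) (QV _ Qy).
have by0 : beta y != 0.
  apply: (support_cell_neq0 (H := H) bb cV _ (QV _ Qy)).
  by case: sQ => z [sz Qz]; exists z; split=> //; exact: QV.
have bx0 : beta x != 0 := support_cell_neq0 bb cP sP Px.
have [beta' bb' [bx' by']] := basis_coarsen hS bb cP cV Px (QV _ Qy) bx0 by0.
have Q0 : Q `<=` dom H 0 by apply: subset_trans Ql _; exact: dom_le.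
have W0 : W `<=` dom H 0 := dom_cell_sub hH (leq0n _) cW (Q0 _ Qy) (QW _ Qy).
apply: subset_trans (@subset_closure _ P') _.
apply: subset_trans subW => z P'z; exists P' => //; split=> //.
exists beta'; split=> //.
  apply: (cell_support x cP' P'0) => w P'w.
  exact: (basis_neq0_cell hS bb' cP' (PP' _ Px) P'w).
apply: (cell_support y cW W0) => w Ww.
exact: (basis_neq0_cell hS bb' cW (QW _ Qy) Ww).
Qed.

Definition admissible_hierarchy H :=
  domain_hierarchy S H /\ strictly_admissible S m H.

Lemma enlarge_extends H l (A : set point) : extends H (enlarge H l.+1 A).
Proof. by split=> // k /= x; case: ifP => // _; left. Qed.

Lemma enlarge_domain_hierarchy H l Q : domain_hierarchy S H -> cell S l Q ->
  Q `<=` dom H l -> domain_hierarchy S (enlarge H l.+1 (closure Q)).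
Proof.
move=> hH cQ Ql; have [dp sub em cl [u0 uS]] := hH; split=> /=.
- by rewrite leq_max dp.
- move=> k x; rewrite eqSS; have [->|kl] := eqVneq k l.
    rewrite ltn_eqF // => -[/sub //|]; exact: closure_dom_sub.
  by move=> /sub; case: ifP => // _; left.
- move=> k; rewrite geq_max => /andP[dk lk].
  by rewrite gtn_eqF // em.
- by move=> k; case: ifP => _ //; apply: closedU => //; exact: closed_closure.
- split=> // k; rewrite eqSS; have [->|kl] := eqVneq k l; last exact: uS.
  have [C CS ->] := uS l; exists (C `|` [set Q]).
    by move=> P [/CS //|->].
  by rewrite bigcup_setU bigcup_set1.
Qed.

(** The new part of the domain of level l + 1 satisfies the admissibility
    condition because its support extension lies in the required domain. *)
Lemma enlarge_admissible H l Q : admissible_hierarchy H -> active S H l Q ->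
  ((m <= l.+1)%N ->
     forall P, support_extension S H Q (l.+1 - m).+1 P ->
       P `<=` dom H (l.+1 - m).+1) ->
  admissible_hierarchy (enlarge H l.+1 (closure Q)).
Proof.
move=> [hH adm] aQ sup; have [cQ Ql _] := aQ.
have hH' := enlarge_domain_hierarchy hH cQ Ql.
have ext := enlarge_extends H l (closure Q); set H' := enlarge _ _ _ in hH' ext *.
split=> // k /andP[mk _] x.
have old : dom H k x -> omega S H' (k - m).+1 x.
  move=> kx; apply: (omega_extends hH' ext); apply: adm (kx); rewrite mk ltnNge.
  apply/negP => dk; have [_ _ /(_ k dk) e _ _] := hH.
  by move: kx; rewrite e.
rewrite /H' /=; case: eqP => // kl -[//|Qx]; rewrite kl in mk *.
have kl' : ((l.+1 - m).+1 <= l)%N by lia.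
have [P cP QP] := cell_ancestor hS kl' cQ.
exists P; last exact: closureS Qx; split=> // z [P' SP' P'z].
apply: ext.2; apply: (closure_dom_sub hH _ P'z); apply: sup => //.
rewrite -(support_extension_extends _ _ ext).
rewrite (support_extension_descendant hH' cP cQ QP) //.
by rewrite ext.1; exact: active_sub_dom0 aQ.
Qed.

End Hierarchies.

(** * The refinement algorithm *)

Lemma list_InP (T : eqType) (s : seq T) x : List.In x s <-> x \in s.
Proof.
elim: s => //= y s IH; rewrite in_cons; split=> [[->|/IH ->]|/orP[/eqP ->|/IH]].
- by rewrite eqxx.
- by rewrite orbT.
- by left.
- by right.
Qed.

Lemma enumerates_finite (T : choiceType) (A : set T) : finite_set A ->
  exists s, enumerates s A.
Proof.
move=> /finite_seqP[s ->]; exists (undup s); split; last first.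
  by move=> x; rewrite list_InP mem_undup.
elim: (undup s) (undup_uniq s) => [_|x {}s IH /= /andP[xs us]]; constructor.
  by rewrite list_InP; exact/negP.
exact: IH.
Qed.

Section Refinement.
Context (R : realType) (d : nat) (S : spline_data R d).
Hypothesis d0 : (0 < d)%N.
Hypothesis hS : nested_spline_spaces S.
Notation point := 'rV[R]_d.
Variables (A : set point) (F : point -> point) (m : nat).
Hypothesis injF : set_inj A F.
Hypothesis hm : (2 <= m)%N.
Implicit Types (H : hierarchy R d) (l k : nat) (x y : point) (P Q : set point).

Definition valid H := admissible_hierarchy S m H /\ dom H 0 = A.

Lemma image_sub_inj P Q : P `<=` A -> Q `<=` A -> F @` P `<=` F @` Q -> P `<=` Q.
Proof.
move=> PA QA sub x Px; have [y Qy e] := sub _ (imageP F Px).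
by rewrite -(injF _ _ e) // inE; [exact: QA | exact: PA].
Qed.

Lemma image_inj P Q : P `<=` A -> Q `<=` A -> F @` P = F @` Q -> P = Q.
Proof. by move=> PA QA e; apply/seteqP; split; apply: image_sub_inj; rewrite // e. Qed.

Lemma active_sub H l Q : valid H -> active S H l Q -> Q `<=` A.
Proof. by move=> [[hH _] <-]; exact: active_sub_dom0. Qed.

Lemma active_image H l k P Q : valid H -> cell S l Q -> Q `<=` A ->
  active S H k P -> F @` Q = F @` P -> k = l /\ P = Q.
Proof.
move=> vH cQ QA aP /(image_inj QA (active_sub vH aP)) e; rewrite -e in aP *.
by split=> //; case: aP => cP _ _; exact: (cell_level_unique hS d0 cP cQ).
Qed.

Lemma meshE H l Q : valid H -> cell S l Q -> Q `<=` A ->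
  mesh S F H (F @` Q) <-> active S H l Q.
Proof.
move=> vH cQ QA; split=> [[k _ [P aP e]]|aQ]; last by exists l => //; exists Q.
by have [<- <-] := active_image vH cQ QA aP (esym e).
Qed.

(** Elements of the neighborhood are coarser, so the recursion is
    well-founded. *)
Lemma neighborhood_coarser H l Q : valid H -> cell S l Q -> Q `<=` A ->
  forall P, neighborhood S F H (F @` Q) m P ->
  exists2 k, (k < l)%N & exists2 P', active S H k P' & P = F @` P'.
Proof.
move=> vH cQ QA P [l' [[Q' [cQ' Q'0] e] ml [P' aP' <-] _]].
have [_ domA] := vH; rewrite domA in Q'0.
move/(image_inj Q'0 QA): e cQ' => -> /(cell_level_unique hS d0 cQ) ll'.
by exists (l'.+1 - m)%N; [lia | exists P'].
Qed.

Lemma neighborhood_finite H l Q : valid H -> cell S l Q -> Q `<=` A ->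
  finite_set (neighborhood S F H (F @` Q) m).
Proof.
move=> vH cQ QA.
have : finite_set (\bigcup_(k in `I_l) [set F @` P | P in cell S k]).
  apply: bigcup_finite => [|k _]; first exact: finite_II.
  exact: finite_image (finite_cells S k).
apply: sub_finite_set => P /(neighborhood_coarser vH cQ QA)[k kl [P' [cP' _ _] ->]].
by exists k => //; exists P'.
Qed.

(** Once the neighborhood of Q has been subdivided, the support extension of Q
    lies in the domain required for subdividing Q: each parent of one of its
    cells was in the domain already or was active, hence in the
    neighborhood. *)
Lemma support_extension_refined H H1 l Q : valid H -> cell S l Q ->
  Q `<=` dom H l -> extends H H1 ->
  (forall k P, cell S k P -> P `<=` dom H k ->
     neighborhood S F H (F @` Q) m (F @` P) -> P `<=` dom H1 k.+1) ->
  (m <= l.+1)%N -> forall P, support_extension S H1 Q (l.+1 - m).+1 P ->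
  P `<=` dom H1 (l.+1 - m).+1.
Proof.
move=> [[hH adm] domA] cQ Ql ext nbh ml P.
rewrite (support_extension_extends S _ _ ext) => SP.
have [P' cP' [PP' P'k]] := support_extension_parent hS hm hH adm cQ Ql ml SP.
apply: (subset_trans PP').
have [P'1|P'1] := pselect (P' `<=` dom H (l.+1 - m).+1).
  by apply: subset_trans P'1 (ext.2 _).
have aP' : active S H (l.+1 - m) P' by apply/(activeE hS _ _ hH).
have Q0 : Q `<=` dom H 0 by apply: subset_trans Ql _; exact: dom_le hH _.
apply: nbh => //; exists l; split=> //; first by exists Q.
  by exists P'.
exists (F @` P); last exact: image_subset.
exists l, Q; split=> //; first by lia.
by exists P => //; rewrite subSn.
Qed.

Lemma subdivision_step H H1 H2 l Q : valid H -> cell S l Q ->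
  Q `<=` dom H l -> extends H H1 -> valid H1 ->
  (forall k P, cell S k P -> P `<=` dom H k ->
     neighborhood S F H (F @` Q) m (F @` P) -> P `<=` dom H1 k.+1) ->
  subdivision S F H1 (F @` Q) H2 ->
  [/\ valid H2, extends H1 H2 & Q `<=` dom H2 l.+1].
Proof.
move=> vH cQ Ql ext vH1 nbh; have [[hH _] domA] := vH.
have QA : Q `<=` A by rewrite -domA; apply: subset_trans Ql _; exact: dom_le hH _.
case=> [[l' [Q' [aQ' e ->]]]|[nmesh ->]]; last first.
  split=> //; first exact: extends_refl.
  have [//|Q1] := pselect (Q `<=` dom H1 l.+1).
  case: nmesh; apply/(meshE vH1 cQ QA)/(activeE hS); first by case: vH1 => -[].
  by split=> //; exact: subset_trans (ext.2 l).
have [ll' QQ'] := active_image vH1 cQ QA aQ' e.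
rewrite {l'}ll' {Q'}QQ' in aQ' e *.
split.
- split; last by case: vH1.
  apply: (enlarge_admissible hS hm _ aQ'); first by case: vH1.
  exact: support_extension_refined vH cQ Ql ext nbh.
- exact: enlarge_extends.
- by move=> x Qx /=; rewrite eqxx; right; exact: subset_closure.
Qed.

Lemma refine_all_nil_inv H H' : refine_all S F m H [::] H' -> H' = H.
Proof. by move=> r; inversion r. Qed.

Lemma refine_all_cons_inv H P s H' : refine_all S F m H (P :: s) H' ->
  exists2 H1, refine_recursive S F m H P H1 & refine_all S F m H1 s H'.
Proof. by move=> r; inversion r; subst; eexists; eassumption. Qed.

Lemma refine_recursive_inv H P H' : refine_recursive S F m H P H' ->
  exists s H1, [/\ enumerates s (neighborhood S F H P m),
    refine_all S F m H s H1 & subdivision S F H1 P H'].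
Proof. by move=> r; inversion r; subst; do 2 eexists; split; eassumption. Qed.

(** The element need not be active: the neighborhood is computed on entry of
    the loop, and the call for one of its members may subdivide others before
    their turn comes. *)
Definition subdivides l := forall H Q H', valid H -> cell S l Q ->
  Q `<=` dom H l -> refine_recursive S F m H (F @` Q) H' ->
  [/\ valid H', extends H H' & Q `<=` dom H' l.+1].

Definition coarse_list H l (s : seq (set point)) := forall P, List.In P s ->
  exists2 k, (k < l)%N &
    exists2 P', cell S k P' /\ P' `<=` dom H k & P = F @` P'.

Lemma coarse_list_extends H H' l s : extends H H' -> coarse_list H l s ->
  coarse_list H' l s.
Proof.
move=> ext cs P /cs[k kl [P' [cP' P'k] ->]]; exists k => //; exists P' => //.
by split=> //; exact: subset_trans (ext.2 k).
Qed.

Lemma coarse_list_neighborhood H l Q s : valid H -> cell S l Q -> Q `<=` A ->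
  enumerates s (neighborhood S F H (F @` Q) m) -> coarse_list H l s.
Proof.
move=> vH cQ QA [_ es] P /es/(neighborhood_coarser vH cQ QA)[k kl [P' aP' ->]].
by exists k => //; exists P' => //; case: aP'.
Qed.

Lemma refine_all_subdivides l H s H' : (forall k, (k < l)%N -> subdivides k) ->
  valid H -> coarse_list H l s -> refine_all S F m H s H' ->
  [/\ valid H', extends H H' & forall k P, cell S k P -> P `<=` dom H k ->
     List.In (F @` P) s -> P `<=` dom H' k.+1].
Proof.
move=> sub; elim: s H => [|P s IH] H vH cs.
  by move=> /refine_all_nil_inv ->; split=> //; exact: extends_refl.
have [|k kl [P' [cP' P'k] e]] := cs P; first by left.
rewrite {P}e in cs * => /refine_all_cons_inv[H1 r1 r2].
have [vH1 ext1 P'1] := sub k kl _ _ _ vH cP' P'k r1.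
have [|vH' ext2 ss] := IH _ vH1 _ r2.
  by apply: (coarse_list_extends ext1) => P Ps; apply: cs; right.
split=> //; first exact: extends_trans ext2.
have [[hH _] domA] := vH.
move=> k' P cP Pk [e|Ps]; last by apply: ss => //; exact: subset_trans (ext1.2 _).
have PA : P `<=` A by rewrite -domA; apply: subset_trans Pk _; exact: dom_le hH _.
have P'A : P' `<=` A by rewrite -domA; apply: subset_trans P'k _; exact: dom_le hH _.
have e' := image_inj P'A PA e; rewrite -e' in cP *.
by rewrite (cell_level_unique hS d0 cP cP'); exact: subset_trans (ext2.2 _).
Qed.

Lemma refine_recursive_subdivides l : subdivides l.
Proof.
elim/ltn_ind: l => l IH H Q H2 vH cQ Ql.
move=> /refine_recursive_inv[s [H1 [es r1 r2]]].
have [[hH _] domA] := vH.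
have QA : Q `<=` A by rewrite -domA; apply: subset_trans Ql _; exact: dom_le hH _.
have [vH1 ext1 nbh] := refine_all_subdivides IH vH
  (coarse_list_neighborhood vH cQ QA es) r1.
have [|vH2 ext2 Q2] := subdivision_step vH cQ Ql ext1 vH1 _ r2.
  by move=> k P cP Pk /es.2; exact: nbh.
by split=> //; exact: extends_trans ext2.
Qed.

Definition runs l := forall H Q, valid H -> cell S l Q -> Q `<=` dom H l ->
  refine_recursive_terminates S F m H (F @` Q) /\
  exists H', refine_recursive S F m H (F @` Q) H'.

Lemma refine_all_runs l H s : (forall k, (k < l)%N -> runs k) ->
  valid H -> coarse_list H l s ->
  refine_all_terminates S F m H s /\ exists H', refine_all S F m H s H'.
Proof.
move=> run; elim: s H => [|P s IH] H vH cs.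
  by split; [constructor | exists H; constructor].
have [|k kl [P' [cP' P'k] e]] := cs P; first by left.
rewrite {P}e in cs *.
have [t [H1 r]] := run k kl _ _ vH cP' P'k.
have rest H'' : refine_recursive S F m H (F @` P') H'' -> valid H'' /\ coarse_list H'' l s.
  move=> /(refine_recursive_subdivides vH cP' P'k)[vH'' ext _]; split=> //.
  by apply: (coarse_list_extends ext) => P Ps; apply: cs; right.
split; first by constructor=> // H'' /rest[vH'' cs'']; case: (IH _ vH'' cs'').
have [vH1 cs1] := rest _ r; have [_ [H' r']] := IH _ vH1 cs1.
by exists H'; econstructor; [exact: r | exact: r'].
Qed.

Lemma subdivision_exists H l Q : valid H -> cell S l Q -> Q `<=` A ->
  exists H', subdivision S F H (F @` Q) H'.
Proof.
move=> vH cQ QA; have [aQ|nm] := pselect (mesh S F H (F @` Q)).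
  exists (enlarge H l.+1 (closure Q)); left; exists l, Q; split=> //.
  exact/(meshE vH cQ QA).
by exists H; right.
Qed.

Lemma refine_recursive_runs l : runs l.
Proof.
elim/ltn_ind: l => l IH H Q vH cQ Ql.
have [[hH _] domA] := vH.
have QA : Q `<=` A by rewrite -domA; apply: subset_trans Ql _; exact: dom_le hH _.
have fin := neighborhood_finite vH cQ QA.
have coarse s := @coarse_list_neighborhood H l Q s vH cQ QA.
split.
  by constructor=> // s /coarse cs; case: (refine_all_runs IH vH cs).
have [s es] := enumerates_finite fin.
have [_ [H1 r1]] := refine_all_runs IH vH (coarse s es).
have [vH1 _ _] := refine_all_subdivides (fun k _ => @refine_recursive_subdivides k)
  vH (coarse s es) r1.
have [H2 r2] := subdivision_exists vH1 cQ QA.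
by exists H2; econstructor; [exact: es | exact: r1 | exact: r2].
Qed.

Lemma mesh_step H H1 Q : valid H -> mesh S F H Q -> refine_recursive S F m H Q H1 ->
  [/\ valid H1, extends H H1 & ~ mesh S F H1 Q].
Proof.
move=> vH [l _ [Q0 aQ <-]] r; have QA := active_sub vH aQ.
have [cQ Ql _] := aQ.
have [vH1 ext Q1] := refine_recursive_subdivides vH cQ Ql r; split=> //.
move=> /(meshE vH1 cQ QA)/(activeE hS)[]; first by case: vH1 => -[].
by [].
Qed.

Lemma refine_valid M H H' : refine S F m M H H' -> valid H ->
  valid H' /\ extends H H'.
Proof.
elim=> {H H'} [H _ vH|H Q H1 H2 [mQ _] r _ IH vH].
  by split=> //; exact: extends_refl.
have [vH1 ext _] := mesh_step vH mQ r.
by have [vH2 ext2] := IH vH1; split=> //; exact: extends_trans ext2.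
Qed.

(** An element of the original mesh that has been subdivided does not come
    back, since the domains only grow; so the number of marked elements in the
    mesh decreases. *)
Lemma mesh_stays H0 H H1 Q : valid H0 -> valid H -> valid H1 ->
  extends H0 H -> extends H H1 -> mesh S F H0 Q -> mesh S F H1 Q -> mesh S F H Q.
Proof.
move=> vH0 vH vH1 ext ext1 [l _ [Q' aQ' <-]].
have Q'A := active_sub vH0 aQ'; have [cQ' Q'l _] := aQ'.
move=> /(meshE vH1 cQ' Q'A)/(activeE hS)[]; first by case: vH1 => -[].
move=> _ _ Q'1; apply/(meshE vH cQ' Q'A)/(activeE hS); first by case: vH => -[].
split=> //; first exact: subset_trans (ext.2 _).
by move=> Q'2; apply: Q'1; exact: subset_trans (ext1.2 _).
Qed.

(** Only the finitely many levels below the depth have nonempty domains. *)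
Lemma mesh_finite H : valid H -> finite_set (mesh S F H).
Proof.
move=> [[hH _] _].
have : finite_set (\bigcup_(k in `I_(depth H)) [set F @` P | P in cell S k]).
  apply: bigcup_finite => [|k _]; first exact: finite_II.
  exact: finite_image (finite_cells S k).
apply: sub_finite_set => _ [l _ [Q [cQ Ql _] <-]]; exists l; last by exists Q.
rewrite /= ltnNge; apply/negP => dl; have [_ _ /(_ l dl) e _ _] := hH.
by have [x /Ql] := cell_nonempty hS cQ; rewrite e.
Qed.

Lemma refine_runs M H0 : valid H0 -> M `<=` mesh S F H0 ->
  refine_terminates S F m M H0 /\ exists H', refine S F m M H0 H'.
Proof.
move=> vH0 MH0.
have /finite_seqP[s0 Ms0] : finite_set M := sub_finite_set MH0 (mesh_finite vH0).
(* Marked elements that have left the mesh never return, so it suffices to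
   keep in s those still present. *)
suff main n : forall H s, (size s <= n)%N -> valid H -> extends H0 H ->
    (forall Q, mesh S F H Q -> M Q -> Q \in s) ->
    refine_terminates S F m M H /\ exists H', refine S F m M H H'.
  apply: (main (size s0) H0 s0) => //; first exact: extends_refl.
  by move=> Q _; rewrite Ms0.
elim: n => [|n IH] H s sn vH ext Hs.
  have none Q : mesh S F H Q -> M Q -> False.
    by move=> mQ MQ; have := Hs Q mQ MQ; case: (s) sn.
  split; last by exists H; constructor; apply/seteqP; split=> // Q [/none].
  by constructor=> [Q [/none nQ /nQ]|Q H1 [/none nQ /nQ]].
have next Q H1 : mesh S F H Q -> M Q -> refine_recursive S F m H Q H1 ->
    refine_terminates S F m M H1 /\ exists H', refine S F m M H1 H'.
  move=> mQ MQ r; have [vH1 ext1 nQ] := mesh_step vH mQ r.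
  apply: (IH H1 (rem Q s)) => //.
  - by rewrite size_rem ?Hs // -subn1 leq_subLR.
  - exact: extends_trans ext1.
  - move=> Q' mQ' MQ'; apply: rem_mem.
      by apply/eqP => e; apply: nQ; rewrite -e.
    by apply: Hs => //; exact: mesh_stays vH0 vH vH1 ext ext1 (MH0 _ MQ') mQ'.
have run Q : mesh S F H Q -> refine_recursive_terminates S F m H Q /\
    exists H', refine_recursive S F m H Q H'.
  by move=> [l _ [Q' [cQ' Q'l _] <-]]; exact: (refine_recursive_runs vH cQ' Q'l).
split.
  constructor=> [Q [mQ _]|Q H1 [mQ MQ] r]; first by case: (run Q mQ).
  by case: (next Q H1 mQ MQ r).
have [e|/eqP/set0P[Q [mQ MQ]]] := pselect (mesh S F H `&` M = set0).
  by exists H; constructor.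
have [_ [H1 r]] := run Q mQ; have [_ [H' r']] := next Q H1 mQ MQ r.
by exists H'; econstructor; [split; [exact: mQ | exact: MQ] | exact: r | exact: r'].
Qed.

End Refinement.

Theorem corollary17 (R : realType) (d : nat) (hd : (0 < d)%N)
    (S : spline_data R d) (hS : nested_spline_spaces S)
    (H : hierarchy R d) (hH : domain_hierarchy S H)
    (Omega : set 'rV[R]_d) (F : 'rV[R]_d -> 'rV[R]_d)
    (hF : bilipschitz_homeomorphism (dom H 0) (closure Omega) F)
    (m : nat) (hm : (2 <= m)%N) (hadm : strictly_admissible S m H)
    (M : set (set 'rV[R]_d)) (hM : M `<=` mesh S F H) :
  [/\ refine_terminates S F m M H,
      exists H', refine S F m M H H' &
      forall H', refine S F m M H H' ->
        [/\ domain_hierarchy S H', strictly_admissible S m H' &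
            refinement S H' H]].
Proof.
have injF : set_inj (dom H 0) F by case: hF => -[].
have vH : valid S (dom H 0) m H by [].
have [term ex] := refine_runs hd hS injF hm vH hM.
split=> // H' /(refine_valid hd hS injF hm)/(_ vH)[[[hH' adm'] _] ext].
by split=> //; exact: extends_refinement ext.
Qed.
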